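(* Let $1\le q<\infty$, $0<\gamma<1$ and $w\in A_q^+(\gamma)$. Then there exist $\varepsilon>0$ and $c>0$ such that \[ \biggl(\frac{1}{|R^-|}\int_{R^-}w^{1+\varepsilon}\biggr)^{\frac{1}{1+\varepsilon}}\le c\,\frac{1}{|R^+|}\int_{R^+}w \] for every parabolic rectangle $R\subset\mathbb{R}^{n+1}$.
   Context: Fix a dimension $n\ge1$ and an exponent $1<p<\infty$. For $x\in\mathbb{R}^n$, $L>0$ let $Q(x,L)=\{y\in\mathbb{R}^n:|y_i-x_i|\le L,\ i=1,\dots,n\}$. For $t\in\mathbb{R}$, the parabolic rectangle centered at $(x,t)$ with side length $L$ is $R=R(x,t,L)=Q(x,L)\times(t-L^p,t+L^p)\subset\mathbb{R}^{n+1}$. For $0\le\gamma<1$ (the time lag) its upper and lower parts are $R^+(\gamma)=Q(x,L)\times(t+\gamma L^p,t+L^p)$ and $R^-(\gamma)=Q(x,L)\times(t-L^p,t-\gamma L^p)$; $R^\pm$ denotes $R^\pm(0)$. $|A|$ is the Lebesgue measure of $A\subset\mathbb{R}^{n+1}$; integrals are with respect to Lebesgue measure. A weight is a locally integrable nonnegative function on $\mathbb{R}^{n+1}$. For $1<q<\infty$, a weight $w$ is in $A_q^+(\gamma)$ if \[ [w]_{A_q^+(\gamma)}=\sup_{R}\biggl(\frac{1}{|R^-(\gamma)|}\int_{R^-(\gamma)}w\biggr)\biggl(\frac{1}{|R^+(\gamma)|}\int_{R^+(\gamma)}w^{\frac1{1-q}}\biggr)^{q-1}<\infty, \] the supremum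 over all parabolic rectangles $R\subset\mathbb{R}^{n+1}$. A weight $w$ is in $A_1^+(\gamma)$ if there is a constant $C=[w]_{A_1^+(\gamma)}>0$ with $\frac{1}{|R^-(\gamma)|}\int_{R^-(\gamma)}w\le C\operatorname{ess\,inf}_{R^+(\gamma)}w$ for every parabolic rectangle $R$. *)

(* Defs.v *)
From HB Require Import structures.
From mathcomp Require Import all_boot all_order all_algebra.
From mathcomp Require Import all_classical all_reals all_analysis.
From mathcomp Require Import measurable_realfun.

Set Implicit Arguments.
Unset Strict Implicit.
Unset Printing Implicit Defensive.

Import Order.TTheory GRing.Theory Num.Theory.
Import numFieldNormedType.Exports.

Local Open Scope classical_set_scope.
Local Open Scope ring_scope.
Local Open Scope ereal_scope.

Notation vect R n := (n.-tuple (measurableTypeR R)).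

(* R^(n+1), as pairs of a point of R^n and a time. *)
Notation spacetime R n := (vect R n * measurableTypeR R)%type.

Section lebesgue_tuple.
Context {R : realType}.

Definition cons_pair n (z : measurableTypeR R * vect R n) : vect R n.+1 :=
  [tuple of z.1 :: z.2].

Lemma measurable_cons_pair n :
  measurable_fun [set: measurableTypeR R * vect R n] (@cons_pair n).
Proof. exact: measurable_cons. Qed.

(* Lebesgue measure on the Borel sets of R^n, as an iterated product; it is
   characterized by sigma-finiteness and [lebesgue_tuple_box]. *)
Fixpoint lebesgue_tuple n : set (vect R n) -> \bar R :=
  match n with
  | 0 => dirac [tuple]
  | n'.+1 => pushforward (lebesgue_measure \x @lebesgue_tuple n') (@cons_pair n')
  end.

Lemma lebesgue_tuple_measure n :
  exists mu : {sigma_finite_measure set (vect R n) -> \bar R},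
    @lebesgue_tuple n = mu.
Proof.
elim: n => [|n [mu E]]; first by exists (dirac [tuple]).
have mc := @measurable_cons_pair n.
pose nu : {measure set (measurableTypeR R * vect R n)%type -> \bar R} :=
  lebesgue_measure \x mu.
have m0 : @lebesgue_tuple n.+1 set0 = 0.
  by rewrite /= E /pushforward preimage_set0 (measure0 nu).
have mge0 A : 0 <= @lebesgue_tuple n.+1 A.
  by rewrite /= E; exact: (measure_ge0 nu).
have msig : semi_sigma_additive (@lebesgue_tuple n.+1).
  rewrite /= E.
  exact: (@measure_semi_sigma_additive _ _ _ (pushforward nu (@cons_pair n))).
have sf : sigma_finite setT (@lebesgue_tuple n.+1).
  have [F FT Foo] : sigma_finite setT nu.
    have /sigma_finiteP[F [TF ndF Foo]] := sigma_finiteT (@lebesgue_measure R).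
    have /sigma_finiteP[G [TG ndG Goo]] := sigma_finiteT mu.
    exists (fun k => F k `*` G k).
      rewrite -setXTT TF TG predeqE => -[x y]; split; last first.
        by move=> [k _ []/= ? ?]; split; exists k.
      move=> [/= [i _ Fix] [j _ Gjy]]; exists (maxn i j) => //; split.
        by move: x Fix; exact/subsetPset/ndF/leq_maxl.
      by move: y Gjy; exact/subsetPset/ndG/leq_maxr.
    move=> k; have [? ?] := Foo k; have [? ?] := Goo k.
    split; first exact: measurableX.
    rewrite [X in X < _](product_measure1E lebesgue_measure mu)//.
    by rewrite lte_mul_pinfty// ge0_fin_numE.
  exists (fun k => (fun v : vect R n.+1 =>
    (thead v, [tuple of behead v])) @^-1` F k).
    by rewrite -preimage_bigcup -FT preimage_setT.
  move=> k; have [mF Fk] := Foo k; split.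
    rewrite -[X in measurable X]setTI.
    apply: (measurable_fun_pair (measurable_tnth ord0) _ measurableT mF).
    exact: measurable_behead.
  rewrite /= E /pushforward -comp_preimage.
  rewrite (_ : _ \o _ = id) //.
  by apply/funext => -[x v] /=; congr pair; exact/val_inj.
pose M := isMeasure.Build _ _ _ (@lebesgue_tuple n.+1) m0 mge0 msig.
pose m : {measure set (vect R n.+1) -> \bar R} := HB.pack (@lebesgue_tuple n.+1) M.
pose S := Measure_isSigmaFinite.Build _ _ _ m sf.
pose m' : {sigma_finite_measure set (vect R n.+1) -> \bar R} :=
  HB.pack (@lebesgue_tuple n.+1) M S.
by exists m'.
Qed.

Let lebesgue_tuple0 n : @lebesgue_tuple n set0 = 0.
Proof. by have [mu ->] := lebesgue_tuple_measure n. Qed.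

Let lebesgue_tuple_ge0 n A : 0 <= @lebesgue_tuple n A.
Proof. by have [mu ->] := lebesgue_tuple_measure n. Qed.

Let lebesgue_tuple_sigma_additive n : semi_sigma_additive (@lebesgue_tuple n).
Proof.
have [mu ->] := lebesgue_tuple_measure n; exact: measure_semi_sigma_additive.
Qed.

HB.instance Definition _ n := isMeasure.Build _ _ _ (@lebesgue_tuple n)
  (lebesgue_tuple0 n) (@lebesgue_tuple_ge0 n) (@lebesgue_tuple_sigma_additive n).

Let lebesgue_tuple_sigma_finite n : sigma_finite setT (@lebesgue_tuple n).
Proof. have [mu ->] := lebesgue_tuple_measure n; exact: sigma_finiteT. Qed.

HB.instance Definition _ n := Measure_isSigmaFinite.Build _ _ _
  (@lebesgue_tuple n) (lebesgue_tuple_sigma_finite n).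

Lemma lebesgue_tuple_box n (A : 'I_n -> set (measurableTypeR R)) :
  (forall i, measurable (A i)) ->
  lebesgue_tuple [set v : vect R n | forall i, A i (tnth v i)] =
  \prod_(i < n) lebesgue_measure (A i).
Proof.
elim: n A => [|n IH] A mA.
  by rewrite big_ord0 /= diracE mem_set//= => -[].
rewrite big_ord_recl -IH//= -product_measure1E //; last first.
  have -> : [set v : vect R n | forall i, A (lift ord0 i) (tnth v i)] =
      \bigcap_(i in [set: 'I_n]) ((@tnth n (measurableTypeR R))^~ i @^-1` A (lift ord0 i)).
    by apply/seteqP; split=> v /= H i => [_|]; exact: H.
  apply: fin_bigcap_measurable; first exact: finite_finset.
  move=> i _; rewrite -[X in measurable X]setTI.
  exact: (measurable_tnth i measurableT (mA _)).
rewrite /pushforward; congr (_ _); apply/seteqP; split=> -[x v] /=.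
  move=> H; split; first exact: (H ord0).
  by move=> i; have := H (lift ord0 i); rewrite /cons_pair tnthS.
by move=> [H0 H] i; case: (unliftP ord0 i) => [j|] ->; rewrite /cons_pair ?tnthS.
Qed.

End lebesgue_tuple.

Section integral_ae.
Import HBNNSimple.

(* No measurability is asked of [f], which may be equal to a Borel function only
   up to a non-Borel null set. *)
Lemma ge0_integral_ae d (T : measurableType d) (R : realType)
    (mu : {measure set T -> \bar R}) (A : set T) (f g : T -> \bar R) :
  measurable A -> measurable_fun setT g ->
  (forall z, 0 <= f z) -> (forall z, 0 <= g z) ->
  (\forall z \ae mu, f z = g z) ->
  \int[mu]_(z in A) f z = \int[mu]_(z in A) g z.
Proof.
move=> mA mg f0 g0 [N [mN N0 fgN]].
have fgE z : (~` N) z -> f z = g z by move=> Nz; apply: contrapT => /fgN.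
have mono (u v : T -> \bar R) : (forall z, 0 <= u z) -> (forall z, 0 <= v z) ->
    (forall z, u z <= v z) -> \int[mu]_z u z <= \int[mu]_z v z.
  move=> u0 v0 uv; rewrite !ge0_integralTE//; apply: ereal_sup_le.
  by move=> _ [h hu <-]; exists h => // z; exact: le_trans (hu z) (uv z).
have p0 (u : T -> \bar R) (B : set T) : (forall z, 0 <= u z) ->
    forall z, 0 <= (u \_ B) z by move=> u0 z; exact: erestrict_ge0.
apply/eqP; rewrite eq_le; apply/andP; split.
  rewrite integral_mkcond ge0_integralTE; last exact: p0.
  apply: ge_ereal_sup => _ [h /= hf <-].
  rewrite -integralT_nnsfun (@ge0_negligible_integral _ _ _ _ _ N)//; last 2 first.
  - exact/measurable_EFinP.
  - by move=> z _; rewrite lee_fin; exact: fun_ge0.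
  rewrite integral_mkcond [leRHS]integral_mkcond; apply: mono => [||z].
  - by apply: p0 => z; rewrite lee_fin; exact: fun_ge0.
  - exact: p0.
  - rewrite /patch; case: ifPn => [|_]; last by case: ifP => // _; exact: g0.
    by rewrite inE /= => -[_ Nz]; rewrite -fgE//; exact: hf.
rewrite (@ge0_negligible_integral _ _ _ _ _ N)//; last first.
  exact: measurable_funTS.
rewrite integral_mkcond [leRHS]integral_mkcond; apply: mono => [||z].
- exact: p0.
- exact: p0.
- rewrite /patch; case: ifPn => [|_]; last by case: ifP => // _; exact: f0.
  by rewrite inE /= => -[Az Nz]; rewrite mem_set// fgE.
Qed.

End integral_ae.

Section parabolic.
Context {R : realType} {n : nat}.
Local Notation mu := ((@lebesgue_tuple R n) \x (@lebesgue_measure R)).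
Implicit Types (w : spacetime R n -> R) (A : set (spacetime R n)).

Record prect := Prect {
  space_center : vect R n;
  time_center : measurableTypeR R;
  side : R;
  side_gt0 : (0 < side)%R }.
Implicit Types Q : prect.

Definition cube (x : vect R n) (L : R) : set (vect R n) :=
  [set y | forall i, (`|(tnth y i : R) - tnth x i| <= L)%R].

Definition upper (p gam : R) Q : set (spacetime R n) :=
  cube (space_center Q) (side Q) `*`
  `](time_center Q + gam * side Q `^ p)%R, (time_center Q + side Q `^ p)%R[.

Definition lower (p gam : R) Q : set (spacetime R n) :=
  cube (space_center Q) (side Q) `*`
  `](time_center Q - side Q `^ p)%R, (time_center Q - gam * side Q `^ p)%R[.

Definition avg A (f : spacetime R n -> \bar R) : \bar R :=
  (mu A)^-1 * \int[mu]_(z in A) f z.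

(* Measurability with respect to the completed sigma-algebra: such a function is
   almost everywhere equal to a Borel function, so by [ge0_integral_ae] its
   library integral, a supremum over Borel simple functions, is its Lebesgue
   integral. *)
Definition lebesgue_measurable w :=
  forall B : set (measurableTypeR R), measurable B ->
    completed_algebra_gen mu (w @^-1` B).

(* Compactness is that of R^n * R with its usual topology, which the library
   puts on row vectors and not on tuples. *)
Definition compact_st A :=
  compact ((fun z => ((\row_i tnth z.1 i)%R, z.2) : 'rV[R]_n * R) @` A).

Definition weight w :=
  [/\ lebesgue_measurable w, forall z, (0 <= w z)%R &
      forall K, compact_st K -> \int[mu]_(z in K) (w z)%:E < +oo].

(* For s < 0 the power is +oo at 0, whereas [powR] takes the value 0 there. *)
Definition neg_pow (a s : R) : \bar R := if a == 0%R then +oo else (a `^ s)%:E.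

(* Products use the convention 0 * +oo = 0. *)
Definition Aq_constant (p gam q : R) w : \bar R :=
  ereal_sup [set avg (lower p gam Q) (fun z => (w z)%:E) *
    (avg (upper p gam Q) (fun z => neg_pow (w z) (1 - q)^-1)) `^ (q - 1)
    | Q in [set: prect]].

Definition ess_inf_on A w : \bar R :=
  ereal_sup [set y | \forall z \ae mu, A z -> y <= (w z)%:E].

Definition A1_plus (p gam : R) w := exists2 C : R, (0 < C)%R &
  forall Q, avg (lower p gam Q) (fun z => (w z)%:E) <=
            C%:E * ess_inf_on (upper p gam Q) w.

Definition muckenhoupt_plus (p gam q : R) w :=
  weight w /\ ((q = 1%R /\ A1_plus p gam w) \/
               ((1 < q)%R /\ Aq_constant p gam q w < +oo)).

End parabolic.
Arguments prect : clear implicits.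

(* Main.v *)
Require Import Defs.
From mathcomp Require Import all_boot all_order all_algebra.
From mathcomp Require Import all_classical all_reals all_analysis.
From mathcomp Require Import measurable_realfun ring lra.

(** The weight is studied on the balls of the parabolic metric
    max(|x - y|, |t - s|^(1/p)), whose ball of radius r has measure proportional
    to r^(n+p); thus covering arguments work as in Euclidean space.

    The Muckenhoupt condition is used once ([average_le_level]): a weight that is
    at most [a] on a fixed portion of an upper part R^+(gam) has average at most
    [C a] on the lower part R^-(gam).  By Chebyshev the integral over R^-(gam) is
    then at most [C] times the integral over any subset of R^+(gam) that fills a
    fixed portion of it ([forward_comparable]).  Two facts follow.

    - If the average of [w] over a ball exceeds [lam], then [w > beta lam] on half
      as much measure inside a concentric enlargement ([fat_levels]).  A ball fits
      into some R^-(gam), and otherwise the small values of [w] would dominate the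
      corresponding R^+(gam).
    - R^-(gam) and R^+(gam) are translates of one another in time, so that the
      comparison can be iterated with small rectangles.  A small ball centered in
      R^- can be squeezed sideways into the spatial cube of R and then moved
      forward, in boundedly many steps, into R^+ ([ball_le_upper]).  The small
      rectangles make up for the missing time lag between R^- and R^+.

    The first fact gives, as in the lemma of Gehring, a reverse Hoelder inequality
    between concentric balls ([reverse_hoelder_ball]).  A stopping-time covering of
    the part of a ball B where [w > lam], for [lam] above a multiple of the average
    over 2B, gives
      int_(B, w > lam) w <= C lam |{w > beta lam} in (3/2)B|
    ([level_set_estimate]).  Summing over the levels 2^i lam with the weights
    (2^i lam)^eps turns this into
      int_B w^(1+eps) <= C lam^eps int_B w + C (2^eps - 1) int_((3/2)B) w^(1+eps).
    The last domain is larger than B, so that the last term cannot be absorbed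
    directly.  Instead, (3/2)B is covered by small balls and the reverse Hoelder
    inequality itself, with an unknown constant X, is applied to each of them: the
    constant X improves to C + X/2 once eps is small.  For a truncated weight some
    X exists, and iteration yields one that does not depend on the truncation
    ([reverse_hoelder_bounded]).

    Covering R^- by small balls, using the reverse Hoelder inequality on each of
    them and moving the resulting averages into R^+ proves the theorem
    ([reverse_hoelder_rectangle]). *)

Set Implicit Arguments.
Unset Strict Implicit.
Unset Printing Implicit Defensive.

Import Order.TTheory GRing.Theory Num.Theory.
Import numFieldNormedType.Exports.

Local Open Scope classical_set_scope.
Local Open Scope ring_scope.
Local Open Scope ereal_scope.


(** * Balls of the parabolic metric *)

Section geometry.
Context {R : realType} {n : nat}.
Local Notation mu := ((@lebesgue_tuple R n) \x (@lebesgue_measure R)).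
Local Notation T := (spacetime R n).
Variable p : R.
Hypothesis p1 : (1 <= p)%R.

Let p0 : (0 < p)%R. Proof. exact: lt_le_trans p1. Qed.

Definition box (x : vect R n) (L a b : R) : set T :=
  cube x L `*` `]a, b[%classic.

(** The parabolic rectangle, as a ball of the metric
    max(|x - y|, |t - s|^(1/p)). *)
Definition pball (z : T) (r : R) : set T :=
  box z.1 r (z.2 - r `^ p)%R (z.2 + r `^ p)%R.

(** The measure of a parabolic ball of radius [r]. *)
Definition vol (r : R) : R := (2 ^+ n.+1 * r `^ (n%:R + p))%R.

Lemma cubeE (x : vect R n) L : cube x L =
  [set v : vect R n | forall i,
     `[(tnth x i - L)%R, (tnth x i + L)%R]%classic (tnth v i)].
Proof.
apply/seteqP; split=> v /= H i; have := H i; rewrite /= in_itv /=.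
  by rewrite ler_distl.
by rewrite ler_distl.
Qed.

Lemma measurable_cube (x : vect R n) L : measurable (cube x L).
Proof.
rewrite cubeE.
have -> : [set v : vect R n | forall i,
     `[(tnth x i - L)%R, (tnth x i + L)%R]%classic (tnth v i)] =
  \bigcap_(i in [set: 'I_n]) ((@tnth n (measurableTypeR R))^~ i @^-1`
     `[(tnth x i - L)%R, (tnth x i + L)%R]%classic).
  by apply/seteqP; split=> v /= H i => [_|]; exact: H.
apply: fin_bigcap_measurable; first exact: finite_finset.
move=> i _; rewrite -[X in measurable X]setTI.
by apply: (measurable_tnth i measurableT); exact: measurable_itv.
Qed.

Lemma lebesgue_cube (x : vect R n) L : (0 <= L)%R ->
  lebesgue_tuple (cube x L) = ((2 * L) ^+ n)%:E.
Proof.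
move=> L0; rewrite cubeE.
rewrite (@lebesgue_tuple_box R n
  (fun i => `[(tnth x i - L)%R, (tnth x i + L)%R]%classic)); last first.
  by move=> i; exact: measurable_itv.
rewrite (eq_bigr (fun=> (2 * L)%:E)); last first.
  move=> i _; rewrite lebesgue_measure_itv /= lte_fin.
  case: ltP => [_|Hle].
    by rewrite -EFinD; congr EFin; ring.
  by congr EFin; lra.
by rewrite prodEFin prodr_const card_ord.
Qed.

Lemma measurable_box x L a b : measurable (box x L a b).
Proof. by apply: measurableX; [exact: measurable_cube|exact: measurable_itv]. Qed.

Lemma measurable_pball z r : measurable (pball z r).
Proof. exact: measurable_box. Qed.

Lemma mu_box x L a b : (0 <= L)%R -> (a <= b)%R ->
  mu (box x L a b) = ((2 * L) ^+ n * (b - a))%:E.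
Proof.
move=> L0 ab; rewrite product_measure1E; [|exact: measurable_cube|exact: measurable_itv].
rewrite EFinM; apply: f_equal2; first exact: lebesgue_cube.
apply: (etrans (lebesgue_measure_itv `]a, b[)); rewrite /= lte_fin.
case: ltP => [_|Hle]; first by rewrite -EFinD.
by congr EFin; lra.
Qed.

Lemma volE r : (0 < r)%R -> vol r = ((2 * r) ^+ n * (2 * r `^ p))%R.
Proof.
move=> r0; have rD : (r `^ (n%:R + p) = r ^+ n * r `^ p)%R.
  by rewrite powRD ?powR_mulrn ?(ltW r0)//; apply/implyP => _; rewrite gt_eqF.
by rewrite /vol rD exprMn exprS; ring.
Qed.

Lemma mu_pball z r : (0 < r)%R -> mu (pball z r) = (vol r)%:E.
Proof.
move=> r0; rewrite mu_box ?(ltW r0)//; last first.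
  by have := powR_ge0 r p; lra.
by congr EFin; rewrite volE//; ring.
Qed.

Lemma vol_gt0 r : (0 < r)%R -> (0 < vol r)%R.
Proof. by move=> r0; rewrite mulr_gt0 ?exprn_gt0 ?powR_gt0. Qed.

Lemma volM k r : (0 <= k)%R -> (0 <= r)%R ->
  vol (k * r) = (k `^ (n%:R + p) * vol r)%R.
Proof. by move=> k0 r0; rewrite /vol powRM//; ring. Qed.

Lemma ler_vol r s : (0 <= r)%R -> (r <= s)%R -> (vol r <= vol s)%R.
Proof.
move=> r0 rs; rewrite ler_wpM2l ?exprn_ge0//; apply: ge0_ler_powR.
- by rewrite addr_ge0// ltW.
- by rewrite nnegrE.
- by rewrite nnegrE (le_trans r0).
- by [].
Qed.

(** This makes |t - s|^(1/p) satisfy the triangle inequality. *)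
Lemma powR_superadd (r s : R) : (0 <= r)%R -> (0 <= s)%R ->
  (r `^ p + s `^ p <= (r + s) `^ p)%R.
Proof.
move=> r0 s0.
have pE (x : R) : (0 <= x)%R -> (x `^ p = x * x `^ (p - 1))%R.
  by move=> x0; rewrite mulr_powRB1.
rewrite !pE ?addr_ge0// mulrDl lerD// ler_wpM2l//.
  by apply: ge0_ler_powR; rewrite ?subr_ge0 ?nnegrE ?addr_ge0 ?lerDl.
by apply: ge0_ler_powR; rewrite ?subr_ge0 ?nnegrE ?addr_ge0 ?lerDr.
Qed.

Lemma ler_powRp (r s : R) : (0 <= r)%R -> (r <= s)%R -> (r `^ p <= s `^ p)%R.
Proof.
move=> r0 rs; apply: ge0_ler_powR; rewrite ?nnegrE ?(ltW p0)//.
exact: le_trans rs.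
Qed.

Lemma pball_sym (y z : T) r : pball y r z -> pball z r y.
Proof.
move=> [/= H1]; rewrite in_itv /= => H2; split=> /=.
  by move=> i; rewrite distrC; exact: H1.
by rewrite in_itv /=; apply/andP; move/andP: H2 => [? ?]; split; lra.
Qed.

Lemma pball_trans (x y z : T) r s : (0 <= r)%R -> (0 <= s)%R ->
  pball x r y -> pball y s z -> pball x (r + s) z.
Proof.
move=> r0 s0 [/= H1 H2] [/= H3 H4]; split=> /=.
  move=> i; apply: le_trans (ler_distD (tnth y.1 i : R) _ _) _.
  by rewrite addrC lerD.
move: H2 H4; rewrite !in_itv /= => /andP[? ?] /andP[? ?].
have := powR_superadd r0 s0.
by move=> ?; apply/andP; split; lra.
Qed.

Lemma sub_pball_center (x y : T) r s : (0 <= r)%R -> (0 <= s)%R ->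
  pball x r y -> pball y s `<=` pball x (r + s).
Proof. by move=> r0 s0 xy z; exact: pball_trans. Qed.

Lemma sub_pball (z : T) r s : (0 <= r)%R -> (r <= s)%R -> pball z r `<=` pball z s.
Proof.
move=> r0 rs y [/= H1 H2]; split=> /=; first by move=> i; exact: le_trans (H1 i) rs.
move: H2; rewrite !in_itv /= => /andP[? ?].
have := ler_powRp r0 rs.
by move=> ?; apply/andP; split; lra.
Qed.

(** The form in which small balls of a covering are enlarged. *)
Lemma sub_pball_meet (y c : T) L r s M : (0 <= L)%R -> (0 <= r)%R -> (0 <= s)%R ->
  (L + r + s <= M)%R -> pball y L `&` pball c r !=set0 -> pball c s `<=` pball y M.
Proof.
move=> L0 r0 s0 LM [u [yu cu]]; have Lr := addr_ge0 L0 r0.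
apply: (subset_trans (sub_pball_center Lr s0 (pball_trans L0 r0 yu (pball_sym cu)))).
by apply: sub_pball => //; exact: addr_ge0.
Qed.

(** A grid with its origin at the corner of the ball, so that natural numbers index
    the nodes near the ball: countably many for all meshes together, finitely many
    for each. *)
Definition node (z : T) (L r : R) (a : (n.-tuple nat * nat)%type) : T :=
  ([tuple (tnth z.1 i - L + r * (tnth a.1 i)%:R)%R | i < n],
   (z.2 - L `^ p + r `^ p * a.2%:R)%R).

Lemma pball_node (z : T) (L r : R) (u : T) : (0 <= L)%R -> (0 < r)%R ->
    pball z L u ->
  exists a : (n.-tuple nat * nat)%type,
    [/\ pball (node z L r a) r u,
        forall i, ((tnth a.1 i)%:R <= 2 * L / r)%R &
        (a.2%:R <= 2 * (L / r) `^ p)%R].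
Proof.
move=> L0 r0 [/= H1 H2].
have rp0 : (0 < r `^ p)%R by exact: powR_gt0.
pose f (i : 'I_n) : R := ((tnth u.1 i - tnth z.1 i + L) / r)%R.
have f0 i : (0 <= f i)%R.
  rewrite divr_ge0 ?(ltW r0)//; have := H1 i; rewrite ler_distl => /andP[? ?].
  by lra.
pose g : R := ((u.2 - z.2 + L `^ p) / r `^ p)%R.
move: H2; rewrite in_itv /= => /andP[H2 H3].
have g0 : (0 <= g)%R by rewrite divr_ge0 ?(ltW rp0)//; lra.
exists ([tuple Num.truncn (f i) | i < n], Num.truncn g); split => /=.
- split=> /=.
    move=> i; rewrite tnth_mktuple tnth_mktuple.
    have /andP[] := truncn_itv (f0 i).
    rewrite -natr1 /f ler_pdivlMr// ltr_pdivrMr// => ? ?.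
    by rewrite ler_distl; apply/andP; split; lra.
  have /andP[] := truncn_itv g0.
  rewrite -natr1 /g ler_pdivlMr// ltr_pdivrMr// => ? ?.
  by rewrite in_itv /=; apply/andP; split; lra.
- move=> i; rewrite tnth_mktuple.
  have /andP[h _] := truncn_itv (f0 i); apply: le_trans h _.
  rewrite /f ler_pM2r ?invr_gt0//.
  by have := H1 i; rewrite ler_distl => /andP[? ?]; lra.
- have /andP[h _] := truncn_itv g0; apply: le_trans h _.
  rewrite /g ler_pdivrMr// -mulrA -powRM ?divr_ge0 ?(ltW r0)//.
  by rewrite divfK ?gt_eqF//; lra.
Qed.

End geometry.


(** * Outer regularity in the parabolic metric *)

Lemma decreasing_small d (T : measurableType d) (R : realType)
    (mu : {measure set T -> \bar R}) (D : set T) (F : (set T)^nat) (eta : R) :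
  measurable D -> mu D < +oo -> (forall k, measurable (F k)) ->
  nonincreasing_seq F -> \bigcap_k F k = set0 -> (0 < eta)%R ->
  exists k, mu (D `&` F k) <= eta%:E.
Proof.
move=> mD Dfin mF dF F0 eta0.
have : mu \o (fun k => D `&` F k) @ \oo --> mu (\bigcap_k (D `&` F k)).
  apply: (@nonincreasing_cvg_mu _ _ _ mu (fun k => D `&` F k)).
  - apply: (le_lt_trans _ Dfin).
    by apply: le_measure; rewrite ?inE//; exact: measurableI.
  - by move=> k; exact: measurableI.
  - by apply: bigcapT_measurable => k; exact: measurableI.
  - move=> i j ij; apply/subsetPset; apply: setIS.
    by apply/subsetPset; exact: dF.
rewrite bigcapIr//.
rewrite F0 setI0 measure0 => /fine_cvgP[fin /cvgrPdist_le /(_ eta eta0) [N _ HN]].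
case: fin => M _ HM.
exists (maxn N M).
have := HN (maxn N M) (leq_maxl _ _); have := HM (maxn N M) (leq_maxr _ _).
rewrite /= => finm.
rewrite sub0r normrN ger0_norm; last by rewrite fine_ge0.
by rewrite -lee_fin fineK.
Qed.

Section regularity.
Context {R : realType} {n : nat}.
Local Notation T := (spacetime R n).
Variables (mu : {measure set T -> \bar R}) (p : R).
Hypothesis p1 : (1 <= p)%R.

(** The open sets of the parabolic metric. *)
Definition popen (G : set T) :=
  forall z, G z -> exists2 r : R, (0 < r)%R & pball p z r `<=` G.

Lemma popen_bigcup I (P : set I) (G : I -> set T) :
  (forall i, P i -> popen (G i)) -> popen (\bigcup_(i in P) G i).
Proof.
move=> oG z [i Pi Giz]; have [r r0 rG] := oG i Pi z Giz.
by exists r => // y /rG Gy; exists i.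
Qed.

Lemma popenI (A B : set T) : popen A -> popen B -> popen (A `&` B).
Proof.
move=> oA oB z [Az Bz].
have [r r0 rA] := oA z Az; have [s s0 sB] := oB z Bz.
exists (Num.min r s); first by rewrite lt_min r0.
move=> y yz; split.
- apply: rA; apply: sub_pball yz => //; last by rewrite ge_min lexx.
  by rewrite le_min !ltW.
- apply: sB; apply: sub_pball yz => //; last by rewrite ge_min lexx orbT.
  by rewrite le_min !ltW.
Qed.

Variable D : set T.
Hypotheses (mD : measurable D) (Dfin : mu D < +oo).

(** Approximation from outside by an open set and from inside by a closed set, up
    to a small measure inside [D].  The two-sided form is what is stable under
    complements. *)
Definition regular (A : set T) := forall eta : R, (0 < eta)%R ->
  exists F G : set T, 
    [/\ measurable F, measurable G, popen (~` F) & popen G] /\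
    [/\ F `<=` A, A `<=` G & mu (D `&` (G `\` F)) <= eta%:E].

Lemma regularC A : regular A -> regular (~` A).
Proof.
move=> rA eta /rA[F [G [[mF mG oF oG] [FA AG e]]]].
exists (~` G), (~` F); split; split; rewrite ?setCK//; try exact: measurableC.
- exact: subsetC.
- exact: subsetC.
- by rewrite (_ : ~` F `\` ~` G = G `\` F)// !setDE setCK setIC.
Qed.

(** An infinite union of closed sets need not be closed: the inner approximation
    is a finite union, and continuity of the measure controls the rest. *)
Lemma regular_bigcup (A : (set T)^nat) :
  (forall k, regular (A k)) -> regular (\bigcup_k A k).
Proof.
move=> rA eta eta0.
have e2 k : (0 < eta / 2 / 2 ^+ k.+1)%R by rewrite !divr_gt0.
have /choice[F /choice[G FG]] k := rA k _ (e2 k).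
pose H k : set T := \big[setU/set0]_(i < k) F i.
have mF k : measurable (F k) by have [[]] := FG k.
have mG k : measurable (G k) by have [[]] := FG k.
have mH k : measurable (H k) by apply: bigsetU_measurable => i _; exact: mF.
have mUF : measurable (\bigcup_k F k) by apply: bigcupT_measurable.
have mUG : measurable (\bigcup_k G k) by apply: bigcupT_measurable.
have mUGF : measurable (\bigcup_k (G k `\` F k)).
  by apply: bigcupT_measurable => k; exact: measurableD.
have [k Hk] : exists k, mu (D `&` ((\bigcup_k F k) `\` H k)) <= (eta / 2)%:E.
  apply: decreasing_small => //.
  - by move=> k; exact: measurableD.
  - move=> i j ij; apply/subsetPset; apply: setDS.
    by apply: subset_bigsetU.
  - apply/seteqP; split=> // z Hz.
    have [[i _ Fi] _] := Hz 0%N I.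
    have [_ []] := Hz i.+1 I.
    by rewrite /H -bigcup_mkord; exists i => //=.
  - by rewrite divr_gt0.
exists (H k), (\bigcup_k G k); split; split => //.
- rewrite /H -bigcup_mkord setC_bigcup.
  elim: (k) => [|m IH].
    by move=> z _; exists 1%R => // y _ i; rewrite /= ltn0.
  have -> : \bigcap_(i in `I_m.+1) ~` F i =
     (\bigcap_(i in `I_m) ~` F i) `&` ~` F m.
    apply/seteqP; split => z.
      move=> h; split; last by apply: h => /=.
      by move=> i im; apply: h => /=; exact: ltnW.
    move=> [h1 h2] i /=; rewrite ltnS leq_eqVlt => /orP[/eqP->//|im].
    exact: h1.
  by apply: popenI => //; have [[]] := FG m.
- by apply: popen_bigcup => i _; have [[]] := FG i.
- rewrite /H -bigcup_mkord => z [i _ Fi]; exists i => //.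
  by have [_ [+ _ _]] := FG i; apply.
- move=> z [i _ Ai]; exists i => //.
  by have [_ [_ + _]] := FG i; apply.
have sub : D `&` (\bigcup_k G k `\` H k) `<=`
    (D `&` ((\bigcup_k F k) `\` H k)) `|` (D `&` \bigcup_k (G k `\` F k)).
  move=> z [Dz [[i _ Gi] nH]].
  have [Fz|nFz] := pselect ((\bigcup_k F k) z); first by left.
  right; split=> //; exists i => //; split=> // Fi.
  by apply: nFz; exists i.
have mD1 : measurable (D `&` ((\bigcup_k F k) `\` H k)).
  by apply: measurableI => //; exact: measurableD.
have mD2 : measurable (D `&` \bigcup_k (G k `\` F k)) by exact: measurableI.
apply: (@le_trans _ _ (mu (D `&` ((\bigcup_k F k) `\` H k)) +
    mu (D `&` \bigcup_k (G k `\` F k)))).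
  apply: le_trans (measureU2 mu mD1 mD2).
  apply: le_measure sub; rewrite ?inE; last exact: measurableU.
  by apply: measurableI => //; exact: measurableD.
rewrite [X in _ <= X%:E](splitr eta) EFinD; apply: leeD => //.
rewrite setI_bigcupr.
have mDk j : measurable (D `&` (G j `\` F j)).
  by apply: measurableI => //; exact: measurableD.
have mUk : measurable (\bigcup_k (D `&` (G k `\` F k))).
  by apply: bigcupT_measurable.
apply: le_trans (measure_sigma_subadditive mu mDk mUk (@subset_refl _ _)) _.
have e20 : (0 <= eta / 2)%R by rewrite divr_ge0 ?ltW.
apply: (le_trans _ (epsilon_trick0 xpredT e20)).
apply: lee_nneseries => j _; first by [].
by have [_ [_ _]] := FG j; rewrite -natrX.
Qed.

Lemma regular_sigma_algebra : sigma_algebra setT regular.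
Proof.
split.
- move=> eta eta0; exists set0, set0; split; split=> //.
  + by rewrite setC0 => z _; exists 1%R.
  + by rewrite setD0 setI0 measure0 lee_fin ltW.
- by move=> A; rewrite setTD; exact: regularC.
- exact: regular_bigcup.
Qed.

(** The preimage of a ray is open, and is exhausted by preimages of closed rays. *)
Lemma regular_preimage (phi : T -> measurableTypeR R) :
  measurable_fun setT phi ->
  (forall z eps, (0 < eps :> R)%R -> exists2 r : R, (0 < r)%R &
     forall u, pball p z r u -> (`|(phi u : R) - phi z| < eps)%R) ->
  forall B, measurable B -> regular (phi @^-1` B).
Proof.
move=> mphi cphi B mB.
have : <<s @RGenInftyO.G R >> `<=` image_set_system setT phi regular.
  apply: smallest_sub.
    apply: sigma_algebra_image; exact: regular_sigma_algebra.
  move=> _ [x ->]; rewrite /image_set_system /= setTI => eta eta0.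
  pose F k := phi @^-1` `[(x - k.+1%:R^-1)%R, x[%classic.
  have [k Hk] : exists k, mu (D `&` F k) <= eta%:E.
    apply: decreasing_small => //.
    - by move=> k; rewrite -[F k]setTI; apply: mphi => //; exact: measurable_itv.
    - move=> i j ij; apply/subsetPset => z; rewrite /F /= !in_itv /= => /andP[h ->].
      rewrite andbT; apply: le_trans h; rewrite lerD2l lerN2.
      by rewrite lef_pV2 ?posrE// ler_nat.
    - apply/seteqP; split=> // z Hz.
      have := Hz 0%N I; rewrite /F /= in_itv /= => /andP[_ zx].
      have := Hz (Num.truncn (x - phi z)^-1) I.
      rewrite /F /= in_itv /= => /andP[+ _].
      rewrite lerBlDr -lerBlDl leNgt => /negP; apply.
      rewrite invf_plt ?posrE ?subr_gt0//.
      exact: truncnS_gt.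
  have mphiS (I : interval R) : measurable (phi @^-1` [set` I]).
    by rewrite -[X in measurable X]setTI; apply: mphi => //; exact: measurable_itv.
  have popen_ray z (P : set R) e : (0 < e)%R ->
      (forall y, (`|y - phi z| < e)%R -> P y) ->
      exists2 r : R, (0 < r)%R & pball p z r `<=` phi @^-1` P.
    by move=> e0 Py; have [r r0 H] := cphi z e e0; exists r => // u /H /Py.
  exists (phi @^-1` `]-oo, (x - k.+1%:R^-1)%R]%classic),
    (phi @^-1` `]-oo, x[%classic); split; split => //.
  - rewrite preimage_setC setCitvl => z /=; rewrite in_itv /= andbT => zk.
    apply: (popen_ray z _ (phi z - (x - k.+1%:R^-1)))%R; first by rewrite subr_gt0.
    by move=> y; rewrite /= in_itv /= andbT ltr_distl subKr => /andP[].
  - move=> z /=; rewrite in_itv /= => zx.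
    apply: (popen_ray z _ (x - phi z))%R; first by rewrite subr_gt0.
    by move=> y; rewrite /= in_itv /= ltr_distl subrKC => /andP[].
  - move=> z /=; rewrite !in_itv /= => /le_lt_trans; apply.
    by rewrite ltrBlDr ltrDl.
  - apply: le_trans Hk; apply: le_measure; rewrite ?inE//.
    + by apply: measurableI => //; exact: measurableD.
    + by apply: measurableI => //; exact: mphiS.
    + apply: setIS => z [/=]; rewrite /F /= !in_itv /= => -> /negP.
      by rewrite -ltNge andbT => /ltW.
move=> h; have := h B; rewrite /image_set_system /= setTI; apply.
have E := RGenInftyO.measurableE R.
change ((@RGenInftyO.G R).-sigma.-measurable B).
by rewrite -E.
Qed.

Lemma measurable_regular (A : set T) : measurable A -> regular A.
Proof.
have sa := regular_sigma_algebra.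
apply: smallest_sub => // {}A [[B mB <-]|[B mB <-]]; rewrite setTI; last first.
  apply: regular_preimage => // z eps eps0.
  exists (eps `^ p^-1)%R; first by rewrite powR_gt0.
  move=> u [_ /=]; rewrite in_itv /= -powRrM mulVf ?gt_eqF//; last first.
    exact: lt_le_trans p1.
  by rewrite powRr1 ?(ltW eps0)// ltr_distl.
suff : measurable `<=` image_set_system setT (@fst (vect R n) (measurableTypeR R)) regular.
  by move=> /(_ B mB); rewrite /image_set_system /= setTI.
apply: smallest_sub; first exact: sigma_algebra_image.
apply: (big_ind (fun X => X `<=` image_set_system setT
  (@fst (vect R n) (measurableTypeR R)) regular)) => //.
  by move=> X Y XS YS; rewrite subUset.
move=> i _ C [E mE <-]; rewrite /image_set_system /= !setTI -comp_preimage.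
apply: (@regular_preimage (fun z => tnth z.1 i)) => //.
  exact: (measurableT_comp (measurable_tnth _)).
move=> z eps eps0; exists (eps / 2)%R; first by rewrite divr_gt0.
move=> u [/= H _]; apply: le_lt_trans (H i) _.
by rewrite ltr_pdivrMr// ltr_pMr// ltr1n.
Qed.

Lemma outer_regular (A : set T) (eta : R) :
  measurable A -> A `<=` D -> (0 < eta)%R ->
  exists G : set T, [/\ measurable G, popen G, A `<=` G & mu (D `&` (G `\` A)) <= eta%:E].
Proof.
move=> mA AD eta0; have [F [G [[mF mG _ oG] [FA AG e]]]] := measurable_regular mA eta0.
exists G; split=> //; apply: le_trans e; apply: le_measure; rewrite ?inE.
- by apply: measurableI => //; exact: measurableD.
- by apply: measurableI => //; exact: measurableD.
- by apply: setIS; apply: setDS.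
Qed.

End regularity.


(** * Vitali coverings *)

(** Greedy choice: take an index of largest radius, discard those that meet it, and
    go on. *)
Lemma vitali_selection (I : eqType) (R : realDomainType) (rad : I -> R)
    (meets : rel I) (s : seq I) : reflexive meets -> symmetric meets ->
  exists D : seq I, [/\ uniq D, {subset D <= s},
    {in D &, forall i j, i != j -> ~~ meets i j} &
    forall i, i \in s -> exists j, [/\ j \in D, meets i j & (rad i <= rad j)%R]].
Proof.
move=> mref msym; have [m] := ubnP (size s); elim: m s => // m IH s sm.
have [->|s0] := eqVneq s [::]; first by exists [::].
have [i0 i0s i0max] : exists2 i0, i0 \in s & forall i, i \in s -> (rad i <= rad i0)%R.
  elim: s s0 {sm} => // a [|b s] IHs _.
    by exists a => [|i]; rewrite inE// => /eqP ->.
  have [//|i0 i0s i0max] := IHs.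
  have [ai|ia] := leP (rad a) (rad i0).
    exists i0; first by rewrite inE i0s orbT.
    by move=> i; rewrite inE => /orP[/eqP ->//|/i0max].
  exists a; first by rewrite inE eqxx.
  by move=> i; rewrite inE => /orP[/eqP ->//|/i0max h]; apply: le_trans h (ltW ia).
pose s' := [seq i <- s | ~~ meets i i0].
have s's : (size s' < size s)%N.
  rewrite size_filter -(count_predC (fun i => meets i i0) s) -[ltnLHS]add0n.
  by rewrite ltn_add2r -has_count; apply/hasP; exists i0.
have [|D [uD Ds Dm Dc]] := IH s'; first exact: leq_trans s's sm.
have Di0 j : j \in D -> ~~ meets j i0 by move/Ds; rewrite mem_filter => /andP[].
exists (i0 :: D); split.
- rewrite /= uD andbT; apply/negP => /Di0.
  by rewrite mref.
- by move=> j; rewrite inE => /orP[/eqP ->//|/Ds]; rewrite mem_filter => /andP[].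
- move=> i j; rewrite !inE => /orP[/eqP ->|iD] /orP[/eqP ->|jD].
  + by rewrite eqxx.
  + by move=> _; rewrite msym Di0.
  + by move=> _; rewrite Di0.
  + exact: Dm.
- move=> i si; have [mi|nmi] := boolP (meets i i0).
    by exists i0; rewrite inE eqxx; split => //; exact: i0max.
  have [|j [jD mj rj]] := Dc i; first by rewrite mem_filter nmi.
  by exists j; rewrite inE jD orbT.
Qed.

Lemma sum_measure_disjoint_le d (T : measurableType d) (R : realType)
    (mu : {measure set T -> \bar R}) (I : eqType) (D : seq I) (X : I -> set T)
    (B : set T) :
  uniq D -> {in D &, forall i j, i != j -> X i `&` X j = set0} ->
  (forall i, measurable (X i)) -> measurable B ->
  (forall i, i \in D -> X i `<=` B) ->
  \sum_(i <- D) mu (X i) <= mu B.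
Proof.
move=> + + mX; elim: D B => [|i D IH] B uD tD mB XB; first by rewrite big_nil.
move: uD => /= /andP[iD uD].
rewrite big_cons.
have Xi : X i `<=` B by apply: XB; rewrite inE eqxx.
rewrite -(setDUK Xi) measureU//; last 2 first.
  exact: measurableD.
  by rewrite setDE setICA setICr setI0.
apply: leeD => //; apply: IH => //.
- by move=> j k jD kD; apply: tD; rewrite inE ?jD ?kD orbT.
- exact: measurableD.
- move=> j jD z Xz; split; first by apply: XB Xz; rewrite inE jD orbT.
  move=> Xiz; have : (X i `&` X j) z by [].
  rewrite tD ?inE ?eqxx ?jD ?orbT//.
  by apply: contraNneq iD => ->.
Qed.

(** Used for a measure and for the integral as a function of the domain. *)
Lemma finite_subadditive d (T : measurableType d) (R : realType)
    (phi : set T -> \bar R) (I : eqType) (D : seq I) (X : I -> set T) (A : set T) :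
  (forall A B, measurable A -> measurable B -> phi (A `|` B) <= phi A + phi B) ->
  (forall A B, measurable A -> measurable B -> A `<=` B -> phi A <= phi B) ->
  (forall i, measurable (X i)) -> measurable A ->
  phi A <= phi (A `\` \bigcup_(i in [set` D]) X i) + \sum_(i <- D) phi (X i).
Proof.
move=> phiU phiS mX; elim: D A => [|i D IH] A mA.
  rewrite big_nil adde0; apply: phiS => //.
    apply: measurableD => //; apply: fin_bigcup_measurable => //.
  by move=> z Az; split => // -[].
have mD (E : seq I) : measurable (\bigcup_(i in [set` E]) X i).
  by apply: fin_bigcup_measurable => //; exact: finite_seq.
rewrite big_cons addeCA; apply: (@le_trans _ _ (phi (X i) + phi (A `\` X i))).
  apply: le_trans (phiU _ _ (mX i) (measurableD mA (mX i))).
  apply: phiS => //; first by apply: measurableU => //; exact: measurableD.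
  by move=> z Az; have [|] := pselect (X i z); [left|right].
apply: leeD => //; apply: le_trans (IH _ (measurableD mA (mX i))) _.
apply: leeD => //; apply: phiS; [| |].
- by apply: measurableD => //; exact: measurableD.
- exact: measurableD.
- move=> z [[Az nX] nD]; split=> // -[j /=]; rewrite inE => /orP[/eqP -> //|jD Xj].
  by apply: nD; exists j.
Qed.

Section covering.
Context {R : realType} {n : nat}.
Local Notation T := (spacetime R n).
Variables (mu : {measure set T -> \bar R}) (p : R).
Hypothesis p1 : (1 <= p)%R.
Hypothesis mu_ball : forall (z : T) (r : R), (0 < r)%R ->
  mu (pball p z r) = (@vol R n p r)%:E.

(** Finitely many balls of the countable cover suffice up to measure [eta], and the
    selection is made on their enlargements by [K], which are then disjoint. *)
Lemma vitali_cover (I : countType) (c : I -> T) (r : I -> R) (P : set I)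
    (A : set T) (K eta : R) :
  measurable A -> mu A < +oo -> (1 <= K)%R -> (0 < eta)%R ->
  (forall i, P i -> (0 < r i)%R) ->
  A `<=` \bigcup_(i in P) pball p (c i) (r i) ->
  exists D : seq I, [/\ uniq D, forall i, i \in D -> P i,
    {in D &, forall i j, i != j ->
       pball p (c i) (K * r i) `&` pball p (c j) (K * r j) = set0} &
    mu (A `\` \bigcup_(i in [set` D]) pball p (c i) (3 * K * r i)) <= eta%:E].
Proof.
move=> mA Afin K1 eta0 r0 AP.
pose s k : seq I := [seq i <- pmap unpickle (iota 0 k) | `[< P i >]].
pose U k := \bigcup_(i in [set` s k]) pball p (c i) (r i).
have mU k : measurable (U k).
  apply: fin_bigcup_measurable; first exact: finite_seq.
  by move=> i _; exact: measurable_pball.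
have [k Hk] : exists k, mu (A `&` (A `\` U k)) <= eta%:E.
  apply: decreasing_small => //.
  - by move=> k; exact: measurableD.
  - move=> k l kl; apply/subsetPset; apply: setDS => z [i /= si zi]; exists i => //=.
    move: si; rewrite !mem_filter => /andP[-> /=].
    rewrite !mem_pmap => /mapP[m mk ->]; apply: map_f.
    by move: mk; rewrite !mem_iota/= !add0n => /leq_trans; apply.
  - apply/seteqP; split=> // z Hz.
    have [Az _] := Hz 0%N Logic.I.
    have [i Pi zi] := AP z Az.
    have [_] := Hz (pickle i).+1 Logic.I; apply.
    exists i => //=; rewrite mem_filter; apply/andP; split; first exact/asboolP.
    by rewrite mem_pmap; apply/mapP; exists (pickle i); rewrite ?pickleK// mem_iota /=.
pose meets i j := `[< pball p (c i) (K * r i) `&` pball p (c j) (K * r j) !=set0 >].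
have K0 : (0 < K)%R by exact: lt_le_trans K1.
have [||D [uD Ds Dd Dc]] := @vitali_selection I _ r
   (fun i j => (i == j) || meets i j) (s k).
- by move=> i; rewrite eqxx.
- by move=> i j; rewrite eq_sym /meets setIC.
exists D; split=> //.
- by move=> i /Ds; rewrite mem_filter => /andP[/asboolP].
- move=> i j iD jD ij; apply: contrapT => /eqP/set0P mij.
  have := Dd i j iD jD ij.
  by rewrite (negbTE ij) /= => /negP; apply; apply/asboolP.
apply: le_trans Hk; apply: le_measure; rewrite ?inE.
- apply: measurableD => //; apply: fin_bigcup_measurable; first exact: finite_seq.
  by move=> i _; exact: measurable_pball.
- by apply: measurableI => //; exact: measurableD.
move=> z [Az nz]; split => //; split => // -[i /= si zi]; apply: nz.
have ri : (0 < r i)%R by apply: r0; move: si; rewrite mem_filter => /andP[/asboolP].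
have [j [jD /orP mij rij]] := Dc i si.
have rj : (0 < r j)%R by exact: lt_le_trans rij.
exists j => //.
have [eij|/asboolP[y [yi yj]]] := mij.
  rewrite -(eqP eij); apply: (sub_pball p1 _ _ zi); first exact: ltW.
  by rewrite ler_pMl//; lra.
have ? : (r i <= K * r i)%R by rewrite ler_pMl.
have ? : (K * r i <= K * r j)%R by rewrite ler_pM2l.
have h : pball p (c j) (K * r j + K * r i + r i) z.
  apply: pball_trans zi => //; first lra.
    lra.
  apply: pball_trans (pball_sym yi) => //; lra.
apply: (sub_pball p1 _ _ h); lra.
Qed.

End covering.


(** * Differentiation of integrals *)

Lemma measureI_fin d (T : measurableType d) (R : realType)
    (mu : {measure set T -> \bar R}) (V A : set T) (x y : R) :
  measurable V -> measurable A -> mu V = x%:E -> mu (V `\` A) = y%:E ->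
  mu (V `&` A) = (x - y)%:E.
Proof.
move=> mV mA VE AE.
have VU : mu V = mu (V `&` A) + mu (V `\` A).
  rewrite -measureU//; first by rewrite setUIDK.
  - exact: measurableI.
  - exact: measurableD.
  - by rewrite setDE setIACA setICr setI0.
by rewrite EFinB -AE -VE VU AE addeK.
Qed.

Lemma measurable_gt d (T : measurableType d) (R : realType) (v : T -> R) (s : R) :
  measurable_fun setT v -> measurable [set z | s < v z]%R.
Proof.
move=> mv; have -> : [set z | s < v z]%R = v @^-1` `]s, +oo[%classic.
  by apply/seteqP; split=> z /=; rewrite in_itv /= andbT.
by rewrite -[X in measurable X]setTI; exact: mv.
Qed.

Lemma measurable_ge d (T : measurableType d) (R : realType) (v : T -> R) (s : R) :
  measurable_fun setT v -> measurable [set z | s <= v z]%R.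
Proof.
move=> mv; have -> : [set z | s <= v z]%R = v @^-1` `[s, +oo[%classic.
  by apply/seteqP; split=> z /=; rewrite in_itv /= andbT.
by rewrite -[X in measurable X]setTI; exact: mv.
Qed.

Section differentiation.
Context {R : realType} {n : nat}.
Local Notation T := (spacetime R n).
Variables (mu : {measure set T -> \bar R}) (p : R).
Hypothesis p1 : (1 <= p)%R.
Hypothesis mu_ball : forall (z : T) (r : R), (0 < r)%R ->
  mu (pball p z r) = (@vol R n p r)%:E.

(** In a Vitali family of balls with average at most [lam], inside an open set that
    exceeds [A] by [eta], each ball must lose to the complement of [A] a fixed
    portion of its measure; hence [mu A] is at most a multiple of [eta]. *)
Lemma small_averages_null_gap (I : countType) (c : I -> T) (r : I -> R) (v : T -> R)
    (lam del : R) (A : set T) (z0 : T) (L : R) :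
  measurable_fun setT v -> (forall z, 0 <= v z)%R -> (0 <= lam)%R -> (0 < del)%R ->
  measurable A -> (0 < L)%R -> A `<=` pball p z0 L ->
  (forall z, A z -> lam + del <= v z)%R ->
  (forall z e, A z -> (0 < e)%R -> exists i, [/\ (0 < r i)%R, (r i < e)%R,
     pball p (c i) (r i) z &
     \int[mu]_(y in pball p (c i) (2 * r i)) (v y)%:E
       <= (lam * @vol R n p (2 * r i))%:E]) ->
  mu A = 0.
Proof.
move=> mv v0 lam0 del0 mA L0 AL vA HA.
pose D := pball p z0 (L + 1).
have mD : measurable D by exact: measurable_pball.
have Dfin : mu D < +oo by rewrite mu_ball ?ltry//; lra.
have AD : A `<=` D by apply: (subset_trans AL); apply: sub_pball => //; lra.
have Afin : mu A < +oo.
  by apply: le_lt_trans Dfin; apply: le_measure; rewrite ?inE.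
pose k3 : R := (3 `^ (n%:R + p))%R.
have k30 : (0 <= k3)%R by exact: powR_ge0.
(* 1 for what the covering misses, the rest for the enlarged balls *)
pose C : R := (1 + k3 * ((lam + del) / del))%R.
have C0 : (0 < C)%R.
  by rewrite ltr_wpDr// mulr_ge0// divr_ge0 ?addr_ge0// ltW.
suff H : forall eta : R, (0 < eta)%R -> mu A <= (C * eta)%:E.
  apply/eqP; rewrite eq_le measure_ge0 andbT; apply/lee_addgt0Pr => e e0.
  rewrite add0e; have := H (e / C)%R; rewrite divr_gt0// => /(_ isT).
  by rewrite mulrC divfK// gt_eqF.
move=> eta eta0.
have [G [mG oG AG Geta]] := @outer_regular R n mu p p1 D mD Dfin A eta mA AD eta0.
pose P := [set i | [/\ (0 < r i)%R, pball p (c i) (2 * r i) `<=` D `&` G &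
     \int[mu]_(y in pball p (c i) (2 * r i)) (v y)%:E
       <= (lam * @vol R n p (2 * r i))%:E]].
have Ar i : P i -> (0 < r i)%R by case.
have AP : A `<=` \bigcup_(i in P) pball p (c i) (r i).
  move=> z Az; have [rz rz0 zG] := oG z (AG z Az).
  pose e := Num.min (rz / 3)%R (3^-1)%R.
  have e0 : (0 < e)%R by rewrite lt_min divr_gt0//= invr_gt0.
  have [i [ri rie zi vi]] := HA z e Az e0.
  exists i => //; split => // y yi.
  have ez : (e <= rz / 3)%R by rewrite ge_min lexx.
  have e3 : (e <= 3^-1)%R by rewrite ge_min lexx orbT.
  have yz : pball p z (r i + 2 * r i) y.
    by apply: pball_trans yi => //; [exact: ltW|lra|exact: pball_sym].
  split; last by apply: zG; apply: (sub_pball p1 _ _ yz); lra.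
  have : pball p z0 (L + (r i + 2 * r i)) y.
    by apply: pball_trans yz => //; [exact: ltW|lra|exact: AL].
  by apply: sub_pball => //; lra.
have [|S [uS SP Sd Sc]] := vitali_cover p1 mA Afin _ eta0 Ar AP (K := 2%R).
  by rewrite ler1n.
have mV i : measurable (pball p (c i) (2 * r i)) by exact: measurable_pball.
pose b i := fine (mu (pball p (c i) (2 * r i) `\` A)).
have bE i : i \in S -> mu (pball p (c i) (2 * r i) `\` A) = (b i)%:E.
  move=> /SP[ri _ _]; rewrite /b fineK// ge0_fin_numE//.
  apply: (@le_lt_trans _ _ (mu (pball p (c i) (2 * r i)))).
    by apply: le_measure; rewrite ?inE//; exact: measurableD.
  by rewrite mu_ball ?ltry//; lra.
have sumb : (\sum_(i <- S) b i <= eta)%R.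
  rewrite -lee_fin -sumEFin; apply: le_trans Geta.
  rewrite big_seq; under eq_bigr => i iS do rewrite -bE//.
  rewrite -big_seq; apply: sum_measure_disjoint_le => //.
  - move=> i j iS jS ij; rewrite !setDE setIACA Sd// set0I//.
  - by move=> i; exact: measurableD.
  - by apply: measurableI => //; exact: measurableD.
  - by move=> i /SP[_ VDG _] z [/VDG[Dz Gz] nA].
have volb i : i \in S -> (@vol R n p (2 * r i) <= (lam + del) / del * b i)%R.
  move=> iS; have [ri _ vi] := SP i iS.
  have VA : mu (pball p (c i) (2 * r i) `&` A) = (@vol R n p (2 * r i) - b i)%:E.
    by apply: measureI_fin => //; [rewrite mu_ball// mulr_gt0|exact: bE].
  rewrite mulrAC ler_pdivlMr//.
  suff : ((lam + del) * (@vol R n p (2 * r i) - b i) <= lam * @vol R n p (2 * r i))%R by lra.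
  rewrite -lee_fin; apply: le_trans vi; rewrite EFinM -VA.
  have mVA : measurable (pball p (c i) (2 * r i) `&` A) by exact: measurableI.
  rewrite -integral_cst//.
  apply: (@le_trans _ _ (\int[mu]_(y in pball p (c i) (2 * r i) `&` A) (v y)%:E)).
    apply: ge0_le_integral => //.
    - by move=> x _; rewrite lee_fin addr_ge0// ltW.
    - by apply/measurable_EFinP; exact: measurable_funTS.
    - by move=> x [_ Ax]; rewrite lee_fin vA.
  apply: ge0_subset_integral => //.
  - by apply/measurable_EFinP; exact: measurable_funTS.
  - by move=> x _; rewrite lee_fin.
apply: le_trans (finite_subadditive (phi := mu)
  (X := fun i => pball p (c i) (3 * 2 * r i)) S _ _ _ mA) _.
- by move=> X Y mX mY; exact: measureU2.
- by move=> X Y mX mY XY; apply: le_measure; rewrite ?inE.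
- by move=> i; exact: measurable_pball.
have -> : (C * eta = eta + k3 * ((lam + del) / del) * eta)%R by rewrite /C; ring.
rewrite EFinD; apply: leeD; first exact: Sc.
rewrite big_seq (eq_bigr (fun i => (k3 * @vol R n p (2 * r i))%:E)); last first.
  move=> i iS; have [ri _ _] := SP i iS.
  by rewrite mu_ball -?mulrA ?volM//; lra.
rewrite -big_seq sumEFin lee_fin -big_distrr /= -mulrA ler_wpM2l//.
apply: (@le_trans _ _ (\sum_(i <- S) (lam + del) / del * b i)%R).
  by rewrite big_seq [leRHS]big_seq; apply: ler_sum => i iS; exact: volb.
by rewrite -big_distrr /= ler_wpM2l// divr_ge0 ?addr_ge0// ltW.
Qed.

(** The half of the Lebesgue differentiation theorem that stopping-time arguments
    use. *)
Lemma small_averages_null (I : countType) (c : I -> T) (r : I -> R) (v : T -> R)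
    (lam : R) (A : set T) (z0 : T) (L : R) :
  measurable_fun setT v -> (forall z, 0 <= v z)%R -> (0 <= lam)%R ->
  measurable A -> (0 < L)%R -> A `<=` pball p z0 L ->
  (forall z, A z -> lam < v z)%R ->
  (forall z e, A z -> (0 < e)%R -> exists i, [/\ (0 < r i)%R, (r i < e)%R,
     pball p (c i) (r i) z &
     \int[mu]_(y in pball p (c i) (2 * r i)) (v y)%:E
       <= (lam * @vol R n p (2 * r i))%:E]) ->
  mu A = 0.
Proof.
move=> mv v0 lam0 mA L0 AL vA HA.
pose A' k := A `&` [set z | lam + k.+1%:R^-1 <= v z]%R.
have mA' k : measurable (A' k).
  by apply: measurableI => //; exact: measurable_ge.
have -> : A = \bigcup_k A' k.
  apply/seteqP; split=> z; last by case=> k _ [].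
  move=> Az; exists (Num.truncn (v z - lam)^-1) => //; split => //=.
  rewrite -lerBrDl invf_ple ?posrE ?subr_gt0 ?vA//.
  by apply: ltW; exact: truncnS_gt.
apply/eqP; rewrite eq_le measure_ge0 andbT.
have mU : measurable (\bigcup_k A' k) by apply: bigcupT_measurable.
apply: le_trans (measure_sigma_subadditive mu mA' mU (@subset_refl _ _)) _.
rewrite eseries0// => k _ _; apply: (@small_averages_null_gap I c r v lam k.+1%:R^-1 _ z0 L) => //.
- by move=> z [/AL].
- by move=> z [].
- by move=> z e [Az _]; exact: HA.
Qed.

End differentiation.


(** * Measure of the level sets *)

Section nonneg_integral.
Context d (T : measurableType d) (R : realType) (mu : {measure set T -> \bar R}).
Variable v : T -> R.
Hypotheses (mv : measurable_fun setT v) (v0 : forall z, (0 <= v z)%R).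

Let mvA (A : set T) : measurable_fun A (fun z => (v z)%:E).
Proof. by apply/measurable_EFinP; exact: measurable_funTS. Qed.

Let v0A (A : set T) z : A z -> 0 <= (v z)%:E.
Proof. by rewrite lee_fin. Qed.

Lemma integral_subset_le (A B : set T) : measurable A -> measurable B -> A `<=` B ->
  \int[mu]_(z in A) (v z)%:E <= \int[mu]_(z in B) (v z)%:E.
Proof. by move=> mA mB AB; apply: ge0_subset_integral => //; exact: v0A. Qed.

Lemma integral_setU_le (A B : set T) : measurable A -> measurable B ->
  \int[mu]_(z in A `|` B) (v z)%:E <=
  \int[mu]_(z in A) (v z)%:E + \int[mu]_(z in B) (v z)%:E.
Proof.
move=> mA mB; have -> : A `|` B = A `|` (B `\` A) by rewrite setUDr setDv setD0.
have mBA : measurable (B `\` A) by exact: measurableD.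
rewrite ge0_integral_setU//; last 2 first.
- by move=> z _; rewrite lee_fin.
- by apply/disj_setPS => z [Az [_]].
by apply: leeD => //; apply: integral_subset_le => // z [].
Qed.

Lemma integral_le_measure (A : set T) (m : R) : measurable A -> (0 <= m)%R ->
  (forall z, A z -> v z <= m)%R -> \int[mu]_(z in A) (v z)%:E <= m%:E * mu A.
Proof.
move=> mA m0 vm; rewrite -integral_cst//; apply: ge0_le_integral => //.
exact: v0A.
Qed.

Lemma integral_finite_cover (I : eqType) (D : seq I) (X : I -> set T) (A : set T) :
  (forall i, measurable (X i)) -> measurable A ->
  \int[mu]_(z in A) (v z)%:E <=
  \int[mu]_(z in A `\` \bigcup_(i in [set` D]) X i) (v z)%:E +
  \sum_(i <- D) \int[mu]_(z in X i) (v z)%:E.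
Proof.
move=> mX mA; apply: (finite_subadditive (phi := fun A => \int[mu]_(z in A) (v z)%:E)) => //.
  exact: integral_setU_le.
exact: integral_subset_le.
Qed.

End nonneg_integral.

Lemma measurable_bigcup_count d (T : measurableType d) (I : countType) (P : set I)
    (X : I -> set T) :
  (forall i, measurable (X i)) -> measurable (\bigcup_(i in P) X i).
Proof.
move=> mX; rewrite bigcup_mkcond; apply: countable_bigcupT_measurable.
  exact: countableP.
by move=> i; case: ifP.
Qed.

Section level_set.
Context {R : realType} {n : nat}.
Local Notation T := (spacetime R n).
Variables (mu : {measure set T -> \bar R}) (p : R).
Hypothesis p1 : (1 <= p)%R.
Hypothesis mu_ball : forall (z : T) (r : R), (0 < r)%R ->
  mu (pball p z r) = (@vol R n p r)%:E.

(** The A_infty condition in a form that survives truncation of [v]: a large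
    average comes from a set of large values that has a fixed proportion, not from
    a concentrated peak. *)
Definition fat_levels (beta K : R) (v : T -> R) := forall z r lam,
  (0 < r)%R -> (0 < lam)%R ->
  (lam * @vol R n p r)%:E < \int[mu]_(y in pball p z r) (v y)%:E ->
  (@vol R n p r / 2)%:E <= mu (pball p z (K * r) `&` [set y | beta * lam < v y]%R).

(** Stopping time: a point where [v > lam] lies, up to a null set, in a ball with
    average above [lam].  At the first such scale the ancestor [J] scales up has
    average at most [lam], which bounds the integral over the enlarged ball, while
    [fat_levels] bounds the measure of the ball by that of [v > beta lam] around it.
    The threshold [A a] makes the first [J] scales good. *)
Lemma level_set_estimate (beta K : R) : (1 <= K)%R ->
  exists A C : R, [/\ (1 <= A)%R, (0 < C)%R & forall (v : T -> R) (m : R),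
    measurable_fun setT v -> (forall z, 0 <= v z <= m)%R -> fat_levels beta K v ->
    forall z0 r0 a lam, (0 < r0)%R ->
      \int[mu]_(y in pball p z0 (2 * r0)) (v y)%:E <= (a * @vol R n p (2 * r0))%:E ->
      (0 < lam)%R -> (A * a <= lam)%R ->
      \int[mu]_(y in pball p z0 r0 `&` [set y | lam < v y]%R) (v y)%:E <=
      (C * lam)%:E * mu (pball p z0 (3 / 2 * r0) `&` [set y | beta * lam < v y]%R)].
Proof.
move=> K1; have Kge0 : (0 <= K)%R by exact: le_trans K1.
(* radii are at most [t r0], so that enlarged balls stay in the ball of radius
   3/2 r0 *)
pose t : R := ((2 * (1 + 2 * K))^-1)%R.
have t0 : (0 < t)%R by rewrite invr_gt0; lra.
have tK : (t * (1 + 2 * K) = 2^-1)%R by rewrite /t; field; rewrite gt_eqF//; lra.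
have t6 : (t <= 6^-1)%R by rewrite /t lef_pV2 ?posrE; lra.
(* a ball enlarged 6 K times fits into the double of its ancestor [J] scales up *)
pose J : nat := (Num.truncn (6 * K + 1)%R).+1.
have J2 : (6 * K + 1 <= 2 ^+ J)%R.
  apply: ltW; apply: lt_le_trans (truncnS_gt _) _.
  by rewrite -natrX ler_nat ltnW// ltn_expl.
have J1 : (1 <= 2 ^+ J :> R)%R by rewrite exprn_ege1// ler1n.
pose A : R := ((2 ^+ J / t) `^ (n%:R + p))%R.
pose C : R := (2 * (2 ^+ J) `^ (n%:R + p))%R.
have np0 : (0 <= n%:R + p)%R by rewrite addr_ge0// (le_trans ler01).
have Jt0 : (1 <= 2 ^+ J / t)%R.
  by rewrite ler_pdivlMr// mul1r; apply: le_trans J1; lra.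
have A1 : (1 <= A)%R.
  have <- : (1 `^ (n%:R + p) = 1 :> R)%R by rewrite powR1.
  by apply: ge0_ler_powR; rewrite ?nnegrE// (le_trans ler01).
exists A, C; split => //; first by rewrite mulr_gt0// powR_gt0// exprn_gt0.
move=> v m mv v0m fat z0 r0 a lam r00 va lam0 Aa.
have v0 z : (0 <= v z)%R by have /andP[] := v0m z.
have m0 : (0 <= m)%R by have /andP[h1 h2] := v0m z0; exact: le_trans h2.
pose rad (k : nat) : R := (r0 * t / 2 ^+ k)%R.
have rad0 k : (0 < rad k)%R by rewrite !mulr_gt0// invr_gt0 exprn_gt0.
have radt k : (rad k <= r0 * t)%R.
  rewrite ler_pdivrMr ?exprn_gt0// ler_peMr ?exprn_ege1 ?ler1n//.
  by rewrite mulr_ge0// ltW.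
pose I : countType := (nat * (n.-tuple nat * nat))%type.
pose r (i : I) := rad i.1.
pose c (i : I) : T := node p z0 r0 (rad i.1) i.2.
pose B i := pball p (c i) (r i).
pose E := pball p z0 r0 `&` [set y | lam < v y]%R.
pose F := [set y | beta * lam < v y]%R.
pose bad i := (lam * @vol R n p (2 * r i))%:E < \int[mu]_(y in pball p (c i) (2 * r i)) (v y)%:E.
(* the balls on which the estimate is summed *)
pose P := [set i | [/\ (@vol R n p (2 * r i) / 2)%:E <= mu (pball p (c i) (2 * K * r i) `&` F),
   pball p (c i) (2 * K * r i) `<=` pball p z0 (3 / 2 * r0) &
   \int[mu]_(y in pball p (c i) (3 * (2 * K) * r i)) (v y)%:E <=
     (lam * @vol R n p (2 ^+ J * (2 * r i)))%:E]].
have mB i : measurable (B i) by exact: measurable_pball.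
have mE : measurable E.
  by apply: measurableI; [exact: measurable_pball|exact: measurable_gt].
have mF : measurable F by exact: measurable_gt.
have cover z k : pball p z0 r0 z -> exists a, B (k, a) z.
  by move=> zB; have [b [Bz _ _]] := pball_node (ltW r00) (rad0 k) zB; exists b.
have stop z i : pball p z0 r0 z -> B i z -> bad i -> (\bigcup_(i in P) B i) z.
  move=> zB Bz badi.
  have ball2 j (s : R) : B j z -> (0 <= s)%R -> pball p (c j) s `<=` pball p z0 (r0 + r j + s).
    move=> Bj s0 y yj; apply: pball_trans yj => //; first by rewrite addr_ge0 ?ltW// /r.
    apply: pball_trans zB _ => //; [exact: ltW|exact: (ltW (rad0 _))|exact: pball_sym].
  (* the first bad level *)
  pose Q k := `[< exists b, B (k, b) z /\ bad (k, b) >].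
  have exQ : exists k, Q k by exists i.1; apply/asboolP; exists i.2; case: (i) Bz badi.
  case: (ex_minnP exQ) => k /asboolP[b [Bb badb]] kmin.
  have good l : (l < k)%N -> forall b, B (l, b) z ->
    \int[mu]_(y in pball p (c (l, b)) (2 * rad l)) (v y)%:E <= (lam * @vol R n p (2 * rad l))%:E.
    move=> lk b' Bb'; rewrite leNgt; apply/negP => h.
    have /kmin : Q l by apply/asboolP; exists b'.
    by rewrite leqNgt lk.
  have Jk : (J < k)%N.
    rewrite ltnNge; apply/negP => kJ.
    move: badb; rewrite /bad ltNge => /negP; apply.
    apply: (@le_trans _ _ (\int[mu]_(y in pball p z0 (2 * r0)) (v y)%:E)).
      apply: integral_subset_le => //; [exact: measurable_pball..|].
      apply: (subset_trans (ball2 (k, b) (2 * rad k)%R Bb _)).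
        by rewrite mulr_ge0// ltW.
      apply: sub_pball => //; rewrite /r /=; have := radt k; have := rad0 k; nra.
    apply: (le_trans va); rewrite lee_fin.
    have -> : (2 * r0 = 2 ^+ k / t * (2 * rad k))%R.
      by rewrite /rad; field; rewrite expf_neq0//= gt_eqF.
    rewrite volM; [|by rewrite divr_ge0 ?(ltW t0)|by rewrite mulr_ge0// ltW].
    rewrite mulrA; apply: ler_wpM2r; first by rewrite ltW// vol_gt0 ?mulr_gt0.
    have [a0|a0] := leP 0%R a; last first.
      by apply: le_trans (ltW lam0); rewrite pmulr_lle0 ?powR_gt0 ?divr_gt0// ltW.
    apply: le_trans Aa; rewrite mulrC ler_wpM2r//.
    apply: ge0_ler_powR; rewrite ?nnegrE ?divr_ge0 ?(ltW t0)//.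
    apply: ler_wpM2r; first by rewrite invr_ge0 ltW.
    by apply: ler_weXn2l => //; rewrite ler1n.
  have [b' Bb'] := cover z (k - J)%N zB.
  have gb := good (k - J)%N (ltac:(by rewrite ltn_subrL (leq_trans _ Jk)))%N b' Bb'.
  have radJ : (rad (k - J)%N = 2 ^+ J * rad k)%R.
    rewrite /rad -[in RHS](subnK (ltnW Jk)) exprD; field.
    by rewrite !expf_neq0.
  exists (k, b) => //; split.
  - have -> : (2 * K * r (k, b) = K * (2 * r (k, b)))%R by ring.
    by apply: fat => //; rewrite mulr_gt0 // (rad0 k).
  - apply: (subset_trans (ball2 (k, b) (2 * K * rad k)%R Bb _)).
      by rewrite mulr_ge0 ?(ltW (rad0 k))// mulr_ge0.
    have rK : (rad k * (1 + 2 * K) <= r0 / 2)%R.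
      rewrite -tK mulrA ler_wpM2r//; lra.
    have K0 : (0 <= 2 * K * rad k)%R by rewrite mulr_ge0 ?(ltW (rad0 k))// mulr_ge0.
    have := rad0 k; rewrite /r /= => rk.
    by apply: sub_pball => //; lra.
  - apply: le_trans (le_trans gb _); last first.
      by have -> : (2 * rad (k - J)%N = 2 ^+ J * (2 * r (k, b)))%R by rewrite radJ mulrCA.
    apply: integral_subset_le => //; [exact: measurable_pball..|].
    have rk := rad0 k.
    have K0 : (0 <= 3 * (2 * K) * rad k)%R by rewrite mulr_ge0 ?(ltW rk)// !mulr_ge0.
    move=> y yV; have h : pball p (c (k - J, b')%N) (rad (k - J)%N + (rad k + 3 * (2 * K) * rad k)) y.
      apply: (pball_trans _ _ _ Bb') => //; [exact: (ltW (rad0 _))|lra|].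
      apply: pball_trans yV => //; first exact: (ltW rk).
      exact: (pball_sym Bb).
    apply: (sub_pball p1 _ _ h); rewrite /= radJ; 
      first by rewrite addr_ge0 ?addr_ge0 ?(ltW rk)// mulr_ge0 ?(ltW rk)// exprn_ge0.
    by have := ler_wpM2r (ltW rk) J2; lra.
have PU : measurable (\bigcup_(i in P) B i) by exact: measurable_bigcup_count.
(* the points of [N] are in good balls at every scale *)
pose N := E `\` \bigcup_(i in P) B i.
have mN : measurable N by exact: measurableD.
have N0 : mu N = 0.
  apply: (@small_averages_null R n mu p p1 mu_ball I c r v lam N z0 r0) => //.
  - exact: ltW.
  - by move=> z [[]].
  - by move=> z [[]].
  - move=> z e [[zB vz] nP] e0.
    pose k := Num.truncn (r0 * t / e)%R.
    have [b Bb] := cover z k zB.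
    exists (k, b); split; [exact: rad0| |exact: Bb|]; rewrite /r /=.
      rewrite /rad ltr_pdivrMr ?exprn_gt0// [ltRHS]mulrC -ltr_pdivrMr//.
      apply: lt_le_trans (truncnS_gt _) _.
      by rewrite -natrX ler_nat ltn_expl.
    rewrite leNgt; apply/negP => h; apply: nP; exact: (stop z (k, b)).
have mE' : measurable (E `&` \bigcup_(i in P) B i) by exact: measurableI.
have Efin : mu (E `&` \bigcup_(i in P) B i) < +oo.
  have : mu (pball p z0 r0) < +oo by rewrite mu_ball// ltry.
  apply: le_lt_trans; apply: le_measure; rewrite ?inE//; first exact: measurable_pball.
  by move=> z [[]].
apply/lee_addgt0Pr => e e0.
have m1 : (0 < m + 1)%R by rewrite ltr_wpDl.
have em : (0 < e / (m + 1))%R by rewrite divr_gt0.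
have [|||D [uD DP Dd De]] := @vitali_cover R n mu p p1 I c r P _ (2 * K)%R _ mE' Efin _ em.
- lra.
- by move=> i _; exact: rad0.
- exact: subIsetr.
pose V3 i := pball p (c i) (3 * (2 * K) * r i).
have mV3 i : measurable (V3 i) by exact: measurable_pball.
have mUV3 : measurable (\bigcup_(i in [set` D]) V3 i) by exact: measurable_bigcup_count.
apply: le_trans (integral_finite_cover mu mv v0 D mV3 mE) _.
rewrite addeC; apply: leeD; last first.
  apply: le_trans (integral_le_measure mu mv v0 _ m0 _) _; [exact: measurableD| |].
    by move=> z _; have /andP[] := v0m z.
  apply: (@le_trans _ _ (m%:E * (e / (m + 1))%:E)).
    apply: lee_wpmul2l; first by rewrite lee_fin.
    apply: le_trans De.
    apply: (@le_trans _ _ (mu (N `|` ((E `&` \bigcup_(i in P) B i) `\` \bigcup_(i in [set` D]) V3 i)))).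
      apply: le_measure; rewrite ?inE; [exact: measurableD| |].
        by apply: measurableU => //; exact: measurableD.
      move=> z [Ez nV].
      by have [Pz|nPz] := pselect ((\bigcup_(i in P) B i) z); [right|left].
    apply: (le_trans (measureU2 mu mN (measurableD mE' mUV3))).
    have N0' : mu N <= 0 by rewrite N0.
    by rewrite -[leRHS]add0e; apply: leeD; [exact: N0'|exact: lexx].
  rewrite -EFinM lee_fin mulrA ler_pdivrMr//; lra.
apply: (@le_trans _ _ (\sum_(i <- D) (C * lam)%:E * mu (pball p (c i) (2 * K * r i) `&` F))).
  rewrite big_seq [leRHS]big_seq; apply: lee_sum => i /DP[h1 _ h3].
  apply: (le_trans h3).
  rewrite volM ?exprn_ge0//; last by rewrite mulr_ge0// (ltW (rad0 _)).
  apply: (@le_trans _ _ ((C * lam)%:E * (@vol R n p (2 * r i) / 2)%:E)).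
    by rewrite -EFinM lee_fin /C; lra.
  by apply: lee_wpmul2l => //; rewrite lee_fin !mulr_ge0 ?powR_ge0// ltW.
rewrite -ge0_sume_distrr//.
apply: lee_wpmul2l; first by rewrite lee_fin !mulr_ge0 ?powR_ge0// ltW.
apply: sum_measure_disjoint_le => //.
- by move=> i j iD jD ij; rewrite setIACA Dd// set0I.
- by move=> i; apply: measurableI => //; exact: measurable_pball.
- by apply: measurableI => //; exact: measurable_pball.
- by move=> i /DP[_ h _]; exact: setSI.
Qed.

End level_set.


(** * From level sets to powers *)

Section dyadic_levels.
Context {R : realType}.
Implicit Types (x lam beta eps : R).

Local Open Scope ring_scope.

Lemma powR_dyadic lam eps i : 0 < lam ->
  (2 ^+ i.+1 * lam) `^ eps = 2 `^ eps * (2 ^+ i * lam) `^ eps.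
Proof. by move=> l0; rewrite exprS -mulrA powRM// mulr_ge0 ?exprn_ge0// ltW. Qed.

Lemma powR1D x eps : 0 <= x -> 0 < eps -> x `^ (1 + eps) = x * x `^ eps.
Proof.
move=> x0 e0; rewrite -(mulr_powRB1 x0 (addr_gt0 ltr01 e0)).
by rewrite addrAC subrr add0r.
Qed.

Lemma powR_ge1 x eps : 0 <= eps -> 1 <= x -> 1 <= x `^ eps.
Proof.
move=> e0 x1; have : 1 `^ eps <= x `^ eps.
  by apply: ge0_ler_powR; rewrite ?nnegrE// (le_trans ler01).
by rewrite powR1.
Qed.

(** Telescoping: the increment of the power from one level to the next is
    [2 `^ eps - 1] times the power of the lower one. *)
Lemma powR_le_dyadic_sum x lam eps N : 0 <= x -> 0 < lam -> 0 < eps ->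
  x <= 2 ^+ N * lam ->
  x `^ eps <= lam `^ eps +
    (2 `^ eps - 1) * \sum_(i < N) (2 ^+ i * lam) `^ eps * \1_[set y | 2 ^+ i * lam < y] x.
Proof.
move=> x0 l0 e0; have p2 : 1 <= 2 `^ eps :> R.
  by apply: powR_ge1; [exact: ltW|rewrite ler1n].
elim: N => [|N IH] xN.
  rewrite big_ord0 mulr0 addr0; move: xN; rewrite expr0 mul1r => xl.
  by apply: ge0_ler_powR; rewrite ?nnegrE// ltW.
rewrite big_ord_recr /=.
have [xl|lx] := leP x (2 ^+ N * lam).
  apply: le_trans (IH xl) _; rewrite lerD2l ler_wpM2l ?subr_ge0// lerDl.
  by rewrite mulr_ge0 ?powR_ge0.
have tel k : lam `^ eps + (2 `^ eps - 1) * \sum_(i < k) (2 ^+ i * lam) `^ eps =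
    (2 ^+ k * lam) `^ eps.
  elim: k => [|k IHk]; first by rewrite big_ord0 mulr0 addr0 expr0 mul1r.
  by rewrite big_ord_recr /= mulrDr addrA IHk powR_dyadic//; ring.
rewrite (eq_bigr (fun i : 'I_N => (2 ^+ i * lam) `^ eps)); last first.
  move=> i _; rewrite indicE mem_set ?mulr1//=; apply: le_lt_trans lx.
  by rewrite ler_pM2r// ler_weXn2l ?ler1n// ltnW.
rewrite indicE mem_set//= mulr1.
have := tel N.+1; rewrite big_ord_recr /= => ->.
by apply: ge0_ler_powR; rewrite ?nnegrE//; [exact: ltW|rewrite mulr_ge0 ?exprn_ge0//; exact: ltW].
Qed.

(** A geometric sum is dominated by twice its last term. *)
Lemma dyadic_sum_le_powR x lam beta eps N : 0 <= x -> 0 < lam -> 0 < beta -> 1 <= eps ->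
  \sum_(i < N) (2 ^+ i * lam) `^ eps * \1_[set y | beta * (2 ^+ i * lam) < y] x
    <= 2 * (x / beta) `^ eps.
Proof.
move=> x0 l0 b0 e1; have p2 : 2 <= 2 `^ eps :> R.
  rewrite -[leLHS]powRr1//; apply: ler_powR => //; exact: ler1n.
have e0 : 0 <= eps by exact: le_trans e1.
have geo k : \sum_(i < k) (2 ^+ i * lam) `^ eps <= (2 ^+ k * lam) `^ eps.
  elim: k => [|k IHk]; first by rewrite big_ord0 powR_ge0.
  rewrite big_ord_recr /= powR_dyadic//.
  have : 0 <= (2 ^+ k * lam) `^ eps by exact: powR_ge0.
  by nra.
elim: N => [|N IH]; first by rewrite big_ord0 mulr_ge0// powR_ge0.
rewrite big_ord_recr /=.
have [xl|lx] := leP x (beta * (2 ^+ N * lam)).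
  rewrite [X in _ + _ * X]indicE memNset ?mulr0 ?addr0//=.
  by apply/negP; rewrite -leNgt.
have lN : (2 ^+ N * lam) `^ eps <= (x / beta) `^ eps.
  apply: ge0_ler_powR; rewrite ?nnegrE//.
  - by rewrite mulr_ge0 ?exprn_ge0// ltW.
  - by rewrite divr_ge0// ltW.
  - by rewrite ler_pdivlMr// mulrC ltW.
have : \sum_(i < N) (2 ^+ i * lam) `^ eps * \1_[set y | beta * (2 ^+ i * lam) < y] x <=
    \sum_(i < N) (2 ^+ i * lam) `^ eps.
  by apply: ler_sum => i _; rewrite ler_piMr ?powR_ge0// indicE lern1 leq_b1.
have : (2 ^+ N * lam) `^ eps * \1_[set y | beta * (2 ^+ N * lam) < y] x <= (2 ^+ N * lam) `^ eps.
  by rewrite ler_piMr ?powR_ge0// indicE lern1 leq_b1.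
have := geo N; lra.
Qed.

End dyadic_levels.

Section power_integral.
Context d (T : measurableType d) (R : realType) (mu : {measure set T -> \bar R}).
Variable v : T -> R.
Hypotheses (mv : measurable_fun setT v) (v0 : forall z, (0 <= v z)%R).

Lemma measurable_powR_fun (s : R) : measurable_fun setT (fun z => v z `^ s)%R.
Proof. exact: (measurableT_comp (measurable_powR s) mv). Qed.

(** The factor [2 `^ eps - 1] in front of the last integral is the gain: it is small
    with [eps]. *)
Lemma power_integral_estimate (B B' : set T) (lam beta C eps : R) (N : nat) :
  measurable B -> measurable B' -> (0 < lam)%R -> (0 < beta)%R -> (0 <= C)%R ->
  (0 < eps)%R ->
  (forall z, v z <= 2 ^+ N * lam)%R ->
  (forall i, \int[mu]_(y in B `&` [set y | 2 ^+ i * lam < v y]%R) (v y)%:E <=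
     (C * (2 ^+ i * lam))%:E * mu (B' `&` [set y | beta * (2 ^+ i * lam) < v y]%R)) ->
  \int[mu]_(y in B) (v y `^ (1 + eps))%:E <=
    (lam `^ eps)%:E * \int[mu]_(y in B) (v y)%:E +
    ((2 `^ eps - 1) * C * (2 * beta^-1 `^ (1 + eps)))%:E *
      \int[mu]_(y in B') (v y `^ (1 + eps))%:E.
Proof.
move=> mB mB' l0 b0 C0 e0 vN level.
have p2 : (0 <= 2 `^ eps - 1 :> R)%R.
  by rewrite subr_ge0; apply: powR_ge1; [exact: ltW|rewrite ler1n].
pose lv i := (2 ^+ i * lam)%R.
have lv0 i : (0 < lv i)%R by rewrite mulr_gt0// exprn_gt0.
have mS (s : R) : measurable [set y | s < v y]%R by exact: measurable_gt.
pose f i z := (lv i `^ eps * (v z * \1_[set y | lv i < v y]%R z))%R.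
have f0 i z : (0 <= f i z)%R by rewrite !mulr_ge0 ?powR_ge0// v0.
have mf i : measurable_fun setT (f i).
  apply: measurable_funM => //; apply: measurable_funM => //.
have mfE D (g : T -> R) : measurable_fun setT g -> measurable_fun D (fun z => (g z)%:E).
  by move=> mg; apply/measurable_EFinP; exact: measurable_funTS.
have pw z : (v z `^ (1 + eps) <= lam `^ eps * v z + (2 `^ eps - 1) * \sum_(i < N) f i z)%R.
  rewrite powR1D//.
  apply: (le_trans (ler_wpM2l (v0 z) (powR_le_dyadic_sum (v0 z) l0 e0 (vN z)))).
  rewrite mulrDr [leLHS]addrC [leRHS]addrC mulrC; apply: lerD; last by rewrite mulrC.
  rewrite -mulrA; apply: ler_wpM2l => //; rewrite mulr_suml.
  apply: ler_sum => i _; rewrite /f !indicE mulrAC -mulrA.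
  by rewrite -/(lv i) mulrCA.
have msum : measurable_fun setT (fun z => \sum_(i < N) f i z)%R.
  by apply: measurable_sum => i.
have sum0 z : (0 <= \sum_(i < N) f i z)%R by apply: sumr_ge0.
apply: (@le_trans _ _ (\int[mu]_(z in B)
   ((lam `^ eps)%:E * (v z)%:E + (2 `^ eps - 1)%:E * (\sum_(i < N) f i z)%:E))).
  apply: ge0_le_integral => //.
  - by move=> z _; rewrite lee_fin powR_ge0.
  - exact/mfE/measurable_powR_fun.
  - apply: emeasurable_funD; apply: measurable_funeM; exact: mfE.
  - by move=> z _; rewrite -!EFinM -EFinD lee_fin.
rewrite ge0_integralD//; last 4 first.
- by move=> z _; rewrite mule_ge0 ?lee_fin ?powR_ge0.
- by apply: measurable_funeM; exact: mfE.
- by move=> z _; rewrite mule_ge0 ?lee_fin.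
- by apply: measurable_funeM; exact: mfE.
rewrite ge0_integralZl_EFin ?powR_ge0//; last 2 first.
- by move=> z _; rewrite lee_fin.
- exact: mfE.
rewrite ge0_integralZl_EFin//; last 2 first.
- by move=> z _; rewrite lee_fin.
- exact: mfE.
apply: leeD => //.
rewrite -!mulrA EFinM -muleA; apply: lee_wpmul2l; first by rewrite lee_fin.
under eq_integral do rewrite -sumEFin.
rewrite ge0_integral_sum//; last 2 first.
- by move=> i; exact: mfE.
- by move=> i z _; rewrite lee_fin.
apply: (@le_trans _ _ (\sum_(i < N) (C * lv i `^ (1 + eps))%:E * 
   mu (B' `&` [set y | beta * lv i < v y]%R))).
  apply: lee_sum => i _.
  under eq_integral do rewrite EFinM.
  rewrite ge0_integralZl_EFin ?powR_ge0//; last 2 first.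
  - by move=> z _; rewrite lee_fin mulr_ge0.
  - by apply: mfE; apply: measurable_funM.
  have -> : (C * lv i `^ (1 + eps) = lv i `^ eps * (C * lv i))%R.
    by rewrite powR1D ?(ltW (lv0 i))//; ring.
  rewrite EFinM -muleA; apply: lee_wpmul2l; first by rewrite lee_fin powR_ge0.
  apply: le_trans (level i); rewrite integral_mkcondr epatch_indic.
  by under eq_integral do rewrite EFinM.
pose h i z := (lv i `^ (1 + eps) * \1_[set y | beta * lv i < y]%R (v z))%R.
have h0 i z : (0 <= h i z)%R by rewrite mulr_ge0 ?powR_ge0.
have hE i z : (h i z = lv i `^ (1 + eps) * \1_[set y | beta * lv i < v y]%R z)%R by rewrite /h !indicE.
have mh i : measurable_fun setT (h i).
  rewrite (_ : h i = fun z => (lv i `^ (1 + eps) * \1_[set y | beta * lv i < v y]%R z)%R).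
    by apply: measurable_funM.
  by apply/funext => z; exact: hE.
have hmu i : (lv i `^ (1 + eps))%:E * mu (B' `&` [set y | beta * lv i < v y]%R) =
    \int[mu]_(z in B') (h i z)%:E.
  under eq_integral do rewrite hE EFinM.
  rewrite ge0_integralZl_EFin ?powR_ge0//; last by apply: mfE.
  by rewrite integral_indic// setIC.
rewrite (eq_bigr (fun i : 'I_N => C%:E * \int[mu]_(z in B') (h i z)%:E)); last first.
  by move=> i _; rewrite EFinM -muleA hmu.
rewrite -ge0_sume_distrr; last by move=> i _; apply: integral_ge0 => z _; rewrite lee_fin.
rewrite [in leRHS]EFinM -muleA; apply: lee_wpmul2l; first by rewrite lee_fin.
rewrite -ge0_integral_sum//; last 2 first.
- by move=> i; exact: mfE.
- by move=> i z _; rewrite lee_fin.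
rewrite -ge0_integralZl_EFin ?mulr_ge0 ?powR_ge0//; last 2 first.
- by move=> z _; rewrite lee_fin powR_ge0.
- exact/mfE/measurable_powR_fun.
apply: ge0_le_integral => //.
- by move=> z _; apply: sume_ge0 => i _; rewrite lee_fin.
- by apply: emeasurable_sum => i; exact: mfE.
- by apply: measurable_funeM; exact/mfE/measurable_powR_fun.
- move=> z _; rewrite sumEFin -EFinM lee_fin.
  have -> : (2 * beta^-1 `^ (1 + eps) * v z `^ (1 + eps) = 2 * (v z / beta) `^ (1 + eps))%R.
    by rewrite powRM ?invr_ge0 ?(ltW b0)//; ring.
  by apply: dyadic_sum_le_powR => //; rewrite lerDl ltW.
Qed.

End power_integral.


(** * Reverse Hoelder inequality on balls *)

Section reverse_hoelder_ball.
Context {R : realType} {n : nat}.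
Local Notation T := (spacetime R n).
Variables (mu : {measure set T -> \bar R}) (p : R).
Hypothesis p1 : (1 <= p)%R.
Hypothesis mu_ball : forall (z : T) (r : R), (0 < r)%R ->
  mu (pball p z r) = (@vol R n p r)%:E.

Lemma finite_ball_cover (rho : R) : (0 <= rho)%R ->
  exists N : nat, forall (z : T) (L r : R), (0 <= L)%R -> (0 < r)%R -> (L <= rho * r)%R ->
  exists S : seq T, [/\ (size S <= N)%N,
    pball p z L `<=` \bigcup_(c in [set` S]) pball p c r &
    forall c, c \in S -> pball p z L `&` pball p c r !=set0].
Proof.
move=> rho0.
pose M := (Num.truncn (2 * rho)%R).+1.
pose M' := (Num.truncn (2 * rho `^ p)%R).+1.
exists (size (enum {: n.-tuple 'I_M}) * size (enum 'I_M'))%N => z L r L0 r0 Lr.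
pose nd (a : n.-tuple 'I_M) (b : 'I_M') :=
  node p z L r ([tuple nat_of_ord (tnth a i) | i < n], nat_of_ord b).
pose S0 := [seq nd a b | a <- enum {: n.-tuple 'I_M}, b <- enum 'I_M'].
exists [seq c <- S0 | `[< pball p z L `&` pball p c r !=set0 >]]; split.
- by rewrite size_filter (leq_trans (count_size _ _))// size_allpairs.
- move=> u zu; have [a [au a1 a2]] := pball_node L0 r0 zu.
  have Lr' : (L / r <= rho)%R by rewrite ler_pdivrMr.
  have M1 i : (tnth a.1 i < M)%N.
    rewrite ltnS truncn_ge_nat ?mulr_ge0//; apply: le_trans (a1 i) _.
    by rewrite -mulrA ler_pM2l.
  have M2 : (a.2 < M')%N.
    rewrite ltnS truncn_ge_nat ?mulr_ge0 ?powR_ge0//; apply: le_trans a2 _.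
    rewrite ler_pM2l//; apply: ler_powRp => //; rewrite divr_ge0// ltW//.
  have ndE : nd [tuple Ordinal (M1 i) | i < n] (Ordinal M2) = node p z L r a.
    rewrite /nd; case: a {au a1 a2} M1 M2 => a1 a2 M1 M2 /=; congr (node _ _ _ _ (_, _)).
    by apply: eq_from_tnth => i; rewrite !tnth_mktuple.
  exists (node p z L r a) => //=; rewrite mem_filter; apply/andP; split.
    by apply/asboolP; exists u.
  by rewrite -ndE; apply: allpairs_f; rewrite mem_enum.
- by move=> c; rewrite mem_filter => /andP[/asboolP].
Qed.

Lemma integral_cover (f : T -> R) (I : eqType) (D : seq I) (X : I -> set T) (A : set T) :
  measurable_fun setT f -> (forall z, 0 <= f z)%R ->
  (forall i, measurable (X i)) -> measurable A ->
  A `<=` \bigcup_(i in [set` D]) X i ->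
  \int[mu]_(z in A) (f z)%:E <= \sum_(i <- D) \int[mu]_(z in X i) (f z)%:E.
Proof.
move=> mf f0 mX mA AX; apply: le_trans (integral_finite_cover mu mf f0 D mX mA) _.
rewrite (_ : A `\` _ = set0) ?integral_set0 ?add0e//.
by apply/seteqP; split => // z [/AX].
Qed.

(** [bound X] is the inequality with constant [X] and with [del] added to the
    average, so that it holds for some [X] when [v] is bounded.  Covering the larger
    ball by small balls and applying [bound X] to these improves [X] to
    [C1 + X / 2]; after enough steps the constant is [2 * C1 + 1].  Since [del] is
    arbitrary, it can be the average itself. *)
Lemma reverse_hoelder_bounded (beta K : R) : (0 < beta)%R -> (beta <= 1)%R -> (1 <= K)%R ->
  exists eps X : R, [/\ (0 < eps)%R, (eps <= 1)%R, (0 < X)%R & forall (v : T -> R) (m : R),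
    measurable_fun setT v -> (forall z, 0 <= v z <= m)%R -> fat_levels mu p beta K v ->
    forall z r a, (0 < r)%R -> (0 < a)%R ->
      \int[mu]_(y in pball p z (2 * r)) (v y)%:E <= (a * @vol R n p (2 * r))%:E ->
      \int[mu]_(y in pball p z r) (v y `^ (1 + eps))%:E <=
        (X * a `^ (1 + eps) * @vol R n p r)%:E].
Proof.
move=> b0 b1 K1.
have [A [C [A1 C0 level]]] := level_set_estimate p1 mu_ball beta K1.
have [N cover] := @finite_ball_cover 12%R (ler0n _ _).
pose E2 : R := (2 `^ (n%:R + p))%R.
pose E8 : R := (8 `^ (n%:R + p))%R.
have np0 : (0 <= n%:R + p)%R by rewrite addr_ge0// (le_trans ler01).
have E21 : (1 <= E2)%R by apply: powR_ge1 => //; rewrite ler1n.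
have E81 : (1 <= E8)%R by apply: powR_ge1 => //; rewrite ler1n.
pose q : R := (C * (2 * beta^-1 ^+ 2) * (N%:R * E8 ^+ 2))%R.
have q0 : (0 <= q)%R.
  by rewrite !mulr_ge0 ?exprn_ge0 ?invr_ge0 ?powR_ge0// ltW.
pose eta : R := ((2 * (q + 1))^-1)%R.
have eta0 : (0 < eta)%R by rewrite invr_gt0; lra.
have eta1 : (eta <= 1)%R by rewrite invf_le1; lra.
have etaq : (eta * q <= 2^-1)%R.
  by rewrite /eta mulrC ler_pdivrMr; lra.
have ln20 : (0 < ln 2 :> R)%R by rewrite ln_gt0// ltr1n.
(* so that [2 `^ eps - 1 = eta] *)
pose eps : R := (ln (1 + eta) / ln 2)%R.
have eps0 : (0 < eps)%R by rewrite divr_gt0// ln_gt0// ltrDl.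
have eps1 : (eps <= 1)%R.
  rewrite ler_pdivrMr// mul1r ler_ln ?posrE//; lra.
have pow2 : (2 `^ eps = 1 + eta)%R.
  by rewrite /powR pnatr_eq0/= /eps divfK ?gt_eqF// lnK// posrE; lra.
have sq (x : R) : (1 <= x)%R -> (x `^ (1 + eps) <= x ^+ 2)%R.
  by move=> x1; rewrite -powR_mulrn ?(le_trans ler01)//; apply: ler_powR => //; lra.
pose C1 : R := (A ^+ 2 * E2)%R.
have C10 : (0 < C1)%R by rewrite mulr_gt0 ?exprn_gt0//; lra.
exists eps, (4 * (2 * C1 + 1))%R; split => //; first by lra.
move=> v m mv v0m fat z r a r0 a0 va.
have v0 y : (0 <= v y)%R by have /andP[] := v0m y.
have m0 : (0 <= m)%R by have /andP[h1 h2] := v0m z; exact: le_trans h2.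
have mvp : measurable_fun setT (fun y => v y `^ (1 + eps))%R by exact: measurable_powR_fun.
have mb (y : T) s : measurable (pball p y s) by exact: measurable_pball.
pose del := a.
pose bound (X : R) := forall z r a, (0 < r)%R -> (0 <= a)%R ->
  \int[mu]_(y in pball p z (2 * r)) (v y)%:E <= (a * @vol R n p (2 * r))%:E ->
  \int[mu]_(y in pball p z r) (v y `^ (1 + eps))%:E <=
  (X * (a + del) `^ (1 + eps) * @vol R n p r)%:E.
have Ew (s : R) : (0 < s)%R -> (0 <= @vol R n p s)%R by move=> s0; rewrite ltW// vol_gt0.
have bound_mono X Y : (X <= Y)%R -> bound X -> bound Y.
  move=> XY bX y s b s0 b0' vb; apply: (le_trans (bX y s b s0 b0' vb)).
  by rewrite lee_fin !ler_wpM2r ?powR_ge0 ?Ew.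
have bound0 : bound ((m / del) `^ (1 + eps))%R.
  move=> y s b s0 b0' _.
  apply: (le_trans (integral_le_measure mu mvp _ (m := (m `^ (1 + eps))%R) _ _ _)).
  - by move=> x; exact: powR_ge0.
  - exact: mb.
  - exact: powR_ge0.
  - move=> x _; have /andP[_ vm] := v0m x.
    by apply: ge0_ler_powR; rewrite ?nnegrE ?addr_ge0// ltW.
  rewrite mu_ball// -EFinM lee_fin ler_wpM2r ?Ew//.
  have -> : (m `^ (1 + eps) = (m / del) `^ (1 + eps) * del `^ (1 + eps))%R.
    by rewrite -powRM ?divr_ge0 ?(ltW a0)// divfK// gt_eqF.
  rewrite ler_wpM2l ?powR_ge0//.
  by apply: ge0_ler_powR; rewrite ?nnegrE ?addr_ge0 ?(ltW a0) ?(ltW eps0)// lerDr.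
(* the self-improvement *)
have step X : (0 <= X)%R -> bound X -> bound (C1 + X / 2)%R.
  move=> X0 bX y s b s0 b0' vb.
  pose w := ((b + del) `^ (1 + eps))%R.
  have w0 : (0 <= w)%R by exact: powR_ge0.
  pose lam := (A * (b + del))%R.
  have bd : (0 < b + del)%R by rewrite ltr_wpDl.
  have lam0 : (0 < lam)%R by rewrite mulr_gt0// (lt_le_trans ltr01).
  have blam : (b <= lam)%R.
    by apply: (@le_trans _ _ (b + del)%R); rewrite ?lerDl ?(ltW a0)// ler_peMl// ltW.
  pose k := Num.truncn (m / lam)%R.
  have mk : (m <= 2 ^+ k * lam)%R.
    rewrite -ler_pdivrMr//; apply: ltW; apply: lt_le_trans (truncnS_gt _) _.
    by rewrite -natrX ler_nat ltn_expl.
  have I3 : \int[mu]_(x in pball p y (3 / 2 * s)) (v x `^ (1 + eps))%:E <=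
      (N%:R * E8 ^+ 2 * X * w * @vol R n p s)%:E.
    have s8 : (0 < s / 8)%R by rewrite divr_gt0.
    have [||S [SN Scov Smeet]] := cover y (3 / 2 * s)%R (s / 8)%R _ s8.
    - by rewrite mulr_ge0// ltW.
    - by clear -s0 mu_ball p1; lra.
    apply: (@le_trans _ _ (\sum_(c <- S) \int[mu]_(x in pball p c (s / 8)) (v x `^ (1 + eps))%:E)).
      apply: (integral_cover (f := fun x => (v x `^ (1 + eps))%R)) => //.
      by move=> x; exact: powR_ge0.
    apply: (@le_trans _ _ (\sum_(c <- S) (E8 ^+ 2 * X * w * @vol R n p s)%:E)).
      rewrite big_seq [leRHS]big_seq; apply: lee_sum => c cS.
      have sub : pball p c (2 * (s / 8)) `<=` pball p y (2 * s).
        by apply: (sub_pball_meet p1 _ _ _ _ (Smeet c cS)); clear -s0 mu_ball p1; lra.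
      have volE : (@vol R n p (2 * s) = E8 * @vol R n p (2 * (s / 8)))%R.
        have s28 : (0 <= 2 * (s / 8))%R by rewrite mulr_ge0 ?(ltW s8).
        by rewrite -(volM p (ler0n R 8) s28); congr (vol _ _); field.
      have vc : \int[mu]_(x in pball p c (2 * (s / 8))) (v x)%:E <=
          (b * E8 * @vol R n p (2 * (s / 8)))%:E.
        by rewrite -mulrA -volE; apply: le_trans vb; exact: (integral_subset_le mu mv v0 (mb _ _) (mb _ _) sub).
      have bE8 : (0 <= b * E8)%R by rewrite mulr_ge0// powR_ge0.
      apply: (le_trans (bX c (s / 8)%R (b * E8)%R s8 bE8 vc)).
      rewrite lee_fin -mulrA [leRHS](_ : _ = X * (E8 ^+ 2 * w * @vol R n p s))%R; last by ring.
      apply: ler_wpM2l => //; apply: ler_pM; rewrite ?powR_ge0 ?Ew//; last first.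
        by apply: ler_vol => //; clear -s0 mu_ball p1; lra.
      apply: (@le_trans _ _ ((E8 * (b + del)) `^ (1 + eps))%R).
        have h : (b * E8 + del <= E8 * (b + del))%R.
          by rewrite mulrDr [(b * E8)%R]mulrC lerD2l ler_peMl// ltW.
        have h0 : (0 <= b * E8 + del)%R by rewrite addr_ge0// ltW.
        have e10 : (0 <= 1 + eps)%R by rewrite addr_ge0// ltW.
        by apply: ge0_ler_powR; rewrite ?nnegrE//; exact: le_trans h.
      by rewrite powRM ?powR_ge0 ?(ltW bd)// ler_wpM2r// sq.
    rewrite sumEFin lee_fin big_const_seq count_predT iter_addr_0 -[leLHS]mulr_natl.
    rewrite -!mulrA; apply: ler_wpM2r; last by rewrite ler_nat.
    by rewrite !mulr_ge0 ?exprn_ge0 ?powR_ge0 ?Ew.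
  have lv i : \int[mu]_(x in pball p y s `&` [set x | 2 ^+ i * lam < v x]%R) (v x)%:E <=
     (C * (2 ^+ i * lam))%:E * mu (pball p y (3 / 2 * s) `&` [set x | beta * (2 ^+ i * lam) < v x]%R).
    apply: (level v m mv v0m fat y s b _ s0 vb); first by rewrite mulr_gt0// exprn_gt0.
    apply: (@le_trans _ _ lam); first by rewrite ler_pM2l ?lerDl ?(ltW a0)// (lt_le_trans ltr01).
    by rewrite ler_peMl ?(ltW lam0)// exprn_ege1// ler1n.
  apply: (le_trans (power_integral_estimate mv v0 (mb _ _) (mb _ _) lam0 b0 (ltW C0) eps0 (N := k) _ lv)).
    by move=> x; have /andP[_ h] := v0m x; exact: le_trans mk.
  have -> : ((C1 + X / 2) * (b + del) `^ (1 + eps) * @vol R n p s =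
     C1 * w * @vol R n p s + X / 2 * w * @vol R n p s)%R by rewrite /w; ring.
  rewrite EFinD; apply: leeD.
    apply: (@le_trans _ _ ((lam `^ eps)%:E * (b * @vol R n p (2 * s))%:E)).
      apply: lee_wpmul2l; first by rewrite lee_fin powR_ge0.
      apply: le_trans vb; apply: integral_subset_le => //.
      by apply: sub_pball => //; clear -s0 mu_ball p1; lra.
    have lamw : (lam `^ eps * b <= A ^+ 2 * w)%R.
      apply: (@le_trans _ _ (lam `^ eps * lam)%R); first by rewrite ler_wpM2l ?powR_ge0.
      rewrite mulrC -powR1D ?(ltW lam0)// powRM ?(ltW bd)//; last by rewrite (le_trans ler01).
      by rewrite ler_wpM2r// sq.
    rewrite -EFinM lee_fin (volM p (ler0n R 2) (ltW s0)) -/E2.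
    have -> : (C1 * w * @vol R n p s = A ^+ 2 * w * (E2 * @vol R n p s))%R.
      by rewrite /C1; ring.
    by rewrite [leLHS]mulrA ler_wpM2r// mulr_ge0 ?powR_ge0 ?Ew.
  rewrite pow2 addrAC subrr add0r.
  apply: (@le_trans _ _ ((eta * C * (2 * beta^-1 `^ (1 + eps)))%:E *
    (N%:R * E8 ^+ 2 * X * w * @vol R n p s)%:E)).
    apply: lee_wpmul2l I3; rewrite lee_fin.
    by rewrite !mulr_ge0 ?powR_ge0 ?(ltW eta0) ?(ltW C0).
  rewrite -EFinM lee_fin mulrA [leRHS](_ : _ = 2^-1 * (X * w * @vol R n p s))%R; last by ring.
  have Xw : (0 <= X * w * @vol R n p s)%R by rewrite mulr_ge0 ?Ew// mulr_ge0.
  apply: le_trans (ler_wpM2r Xw etaq).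
  rewrite /q [leLHS](_ : _ = (eta * C * 2 * N%:R * E8 ^+ 2 * X * w * @vol R n p s) *
    (beta^-1 `^ (1 + eps)))%R; last by ring.
  rewrite [leRHS](_ : _ = (eta * C * 2 * N%:R * E8 ^+ 2 * X * w * @vol R n p s) *
    (beta^-1 ^+ 2))%R; last by ring.
  apply: ler_wpM2l; last by apply: sq; rewrite invf_ge1.
  by rewrite !mulr_ge0 ?powR_ge0 ?exprn_ge0 ?powR_ge0 ?(ltW eta0) ?(ltW C0) ?Ew.
pose X0 := ((m / del) `^ (1 + eps))%R.
have X00 : (0 <= X0)%R by exact: powR_ge0.
have iter k : bound (2 * C1 + X0 / 2 ^+ k)%R.
  elim: k => [|k IH].
    by apply: bound_mono bound0; rewrite expr0 divr1 lerDr mulr_ge0// ltW.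
  apply: bound_mono (step _ _ IH).
    by rewrite le_eqVlt; apply/orP; left; apply/eqP; rewrite exprS; field; rewrite expf_neq0.
  have C10' := ltW C10; apply: addr_ge0; first exact: mulr_ge0.
  by apply: divr_ge0 => //; apply: exprn_ge0.
pose k := Num.truncn X0.
have kX : (X0 / 2 ^+ k <= 1)%R.
  rewrite ler_pdivrMr ?exprn_gt0// mul1r; apply: ltW; apply: lt_le_trans (truncnS_gt _) _.
  by rewrite -natrX ler_nat ltn_expl.
have bX : bound (2 * C1 + 1)%R by apply: bound_mono (iter k); rewrite lerD2l.
apply: (le_trans (bX z r a r0 (ltW a0) va)).
rewrite lee_fin ler_wpM2r ?Ew// /del.
have -> : (a + a = 2 * a)%R by ring.
have four : (2 `^ (1 + eps) <= 4 :> R)%R.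
  by apply: le_trans (sq 2%R _) _; rewrite ?ler1n// expr2 -natrM.
have C12 : (0 <= 2 * C1 + 1)%R by rewrite addr_ge0// mulr_ge0// ltW.
rewrite powRM ?(ltW a0)// [leLHS]mulrA ler_wpM2r ?powR_ge0//.
by rewrite [leLHS]mulrC ler_wpM2r.
Qed.

End reverse_hoelder_ball.


(** Off a null set, the preimages of the countably many rational rays are Borel. *)
Lemma borel_version d (T : measurableType d) (R : realType)
    (mu : {measure set T -> \bar R}) (w : T -> R) :
  (forall B : set (measurableTypeR R), measurable B ->
     completed_algebra_gen mu (w @^-1` B)) ->
  (forall z, 0 <= w z)%R ->
  exists g : T -> R, [/\ measurable_fun setT g, forall z, (0 <= g z)%R &
    \forall z \ae mu, w z = g z].
Proof.
move=> lw w0.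
pose ray (q : rat) : set (measurableTypeR R) := `](ratr q : R), +oo[%classic.
have /choice[A /choice[N AN]] : forall q : rat, exists A N, [/\ measurable A,
    measurable N, mu N = 0, A `<=` w @^-1` ray q & w @^-1` ray q `<=` A `|` N].
  move=> q; have mq : measurable (ray q) by exact: measurable_itv.
  have [A mA [N0 [N [mN N0' NN]] e]] := lw (ray q) mq.
  exists A, N; split => //.
    by rewrite -e => z; left.
  by rewrite -e; apply: setUS.
pose Ns k := if unpickle k is Some q then N q else set0.
have mNs k : measurable (Ns k) by rewrite /Ns; case: unpickle => // q; have [] := AN q.
pose NN := \bigcup_k Ns k.
have mNN : measurable NN by apply: bigcupT_measurable.
have NN0 : mu.-negligible NN.
  apply: negligible_bigcup => k; exists (Ns k); split => //.
  by rewrite /Ns; case: unpickle => [q|]; [have [] := AN q|rewrite measure0].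
have Nq q z : N q z -> NN z.
  by move=> h; exists (pickle q); [exact: Logic.I|rewrite /Ns pickleK].
exists (fun z => if z \in NN then 0%R else w z); split.
- apply: (measurability (@RGenOInfty.G R)); first exact: RGenOInfty.measurableE.
  move=> _ [_ [x ->] <-]; rewrite setTI.
  have -> : (fun z => if z \in NN then 0%R else w z) @^-1` `]x, +oo[%classic =
     (\bigcup_(q in [set q : rat | (x < ratr q)%R]) (A q `\` NN)) `|`
     (if (x < 0)%R then NN else set0).
    apply/seteqP; split => z /=; rewrite in_itv /= andbT.
      case: ifPn => zN xz; first by right; rewrite xz; rewrite inE in zN.
      left; have [q] := @rat_in_itvoo R x (w z) xz.
      rewrite in_itv /= => /andP[xq qw]; exists q => //.
      have nN : ~ NN z by move: zN; rewrite notin_setE.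
      split => //; have [_ _ _ _ /(_ z)] := AN q.
      by rewrite /ray /= in_itv /= qw => /(_ isT)[//|/Nq].
    move=> [[q /= xq [Aq nN]]|].
      rewrite memNset//; apply: lt_trans xq _.
      by have [_ _ _ /(_ z Aq)] := AN q; rewrite /ray /= in_itv /= andbT.
    by case: ifP => // x0 zN; rewrite mem_set.
  apply: measurableU; last by case: ifP.
  apply: measurable_bigcup_count => q; apply: measurableD => //.
  by have [] := AN q.
- by move=> z; case: ifP.
- apply: negligibleS NN0 => z /=.
  by case: ifPn; [rewrite inE|].
Qed.

Section reverse_hoelder_ball.
Context {R : realType} {n : nat}.
Local Notation T := (spacetime R n).
Variables (mu : {measure set T -> \bar R}) (p : R).
Hypothesis p1 : (1 <= p)%R.
Hypothesis mu_ball : forall (z : T) (r : R), (0 < r)%R ->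
  mu (pball p z r) = (@vol R n p r)%:E.

(** If the truncation at height [m] has average above [lam], then [lam < m], so that
    the truncation does not change the set [w > beta lam]. *)
Lemma fat_levels_truncate (beta K : R) (w : T -> R) (m : R) :
  (0 <= beta)%R -> (beta <= 1)%R -> (0 <= m)%R ->
  measurable_fun setT w -> (forall z, 0 <= w z)%R ->
  fat_levels mu p beta K w -> fat_levels mu p beta K (fun z => Num.min (w z) m).
Proof.
move=> b0 b1 m0 mw w0 fat z r lam r0 lam0 h.
have mv : measurable_fun setT (fun z => Num.min (w z) m) by exact: measurable_minr.
have v0 y : (0 <= Num.min (w y) m)%R by rewrite le_min w0.
have mB : measurable (pball p z r) by exact: measurable_pball.
have lm : (lam < m)%R.
  have := lt_le_trans h (integral_le_measure mu mv v0 mB m0 _).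
  rewrite mu_ball// -EFinM lte_fin ltr_pM2r ?vol_gt0//; apply => y _.
  by rewrite ge_min lexx orbT.
apply: le_trans (fat z r lam r0 lam0 _) _.
  apply: lt_le_trans h _; apply: ge0_le_integral => //.
  - by move=> y _; rewrite lee_fin.
  - by apply/measurable_EFinP; exact: measurable_funTS.
  - by apply/measurable_EFinP; exact: measurable_funTS.
  - by move=> y _; rewrite lee_fin ge_min lexx.
apply: le_measure; rewrite ?inE.
- by apply: measurableI; [exact: measurable_pball|exact: measurable_gt].
- by apply: measurableI; [exact: measurable_pball|exact: measurable_gt].
apply: setIS => y /= wy; rewrite lt_min wy /=; apply: le_lt_trans lm.
by rewrite ler_piMl// ltW.
Qed.

Lemma reverse_hoelder_ball (beta K : R) : (0 < beta)%R -> (beta <= 1)%R -> (1 <= K)%R ->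
  exists eps X : R, [/\ (0 < eps)%R, (0 < X)%R & forall (w : T -> R),
    measurable_fun setT w -> (forall z, 0 <= w z)%R -> fat_levels mu p beta K w ->
    forall z r a, (0 < r)%R -> (0 < a)%R ->
      \int[mu]_(y in pball p z (2 * r)) (w y)%:E <= (a * @vol R n p (2 * r))%:E ->
      \int[mu]_(y in pball p z r) (w y `^ (1 + eps))%:E <=
        (X * a `^ (1 + eps) * @vol R n p r)%:E].
Proof.
move=> b0 b1 K1.
have [eps [X [e0 _ X0 H]]] := reverse_hoelder_bounded p1 mu_ball b0 b1 K1.
exists eps, X; split => // w mw w0 fat z r a r0 a0 wa.
have e10 : (0 <= 1 + eps)%R by rewrite addr_ge0// ltW.
have mB s : measurable (pball p z s) by exact: measurable_pball.
pose v k y := Num.min (w y) k%:R.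
have mv k : measurable_fun setT (v k) by exact: measurable_minr.
have v0 k y : (0 <= v k y)%R by rewrite le_min w0 ler0n.
pose f k y := (v k y `^ (1 + eps))%:E.
have mf k : measurable_fun (pball p z r) (f k).
  by apply/measurable_EFinP; apply: measurable_funTS; exact: measurable_powR_fun.
have f0 k y : pball p z r y -> 0 <= f k y by move=> _; rewrite lee_fin powR_ge0.
have ndf y : pball p z r y -> {homo f^~ y : k l / (k <= l)%N >-> k <= l}.
  move=> _ k l kl; rewrite lee_fin; apply: ge0_ler_powR; rewrite ?nnegrE//.
  by rewrite le_min ge_min lexx /= ge_min ler_nat kl orbT.
have limf y : limn (f^~ y) = (w y `^ (1 + eps))%:E.
  apply: lim_near_cst => //.
  exists (Num.truncn (w y)).+1 => // k /= kw.
  rewrite /f /v min_l//; apply: ltW; apply: lt_le_trans (truncnS_gt _) _.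
  by rewrite ler_nat.
under eq_integral do rewrite -limf.
rewrite monotone_convergence//; apply: lime_le.
  apply: ereal_nondecreasing_is_cvgn => k l kl.
  apply: ge0_le_integral => //; first by move=> y By; exact: f0.
  by move=> y By; exact: (ndf y By).
apply: nearW => k; apply: (H (v k) k%:R) => //.
- by move=> y; rewrite v0 /v ge_min lexx orbT.
- by apply: fat_levels_truncate => //; exact: ltW.
- apply: le_trans wa; apply: ge0_le_integral => //.
  + by move=> y _; rewrite lee_fin.
  + by apply/measurable_EFinP; exact: measurable_funTS.
  + by apply/measurable_EFinP; exact: measurable_funTS.
  + by move=> y _; rewrite lee_fin ge_min lexx.
Qed.

End reverse_hoelder_ball.

(** * Local integrability *)

Section local_integrability.
Context {R : realType} {n : nat}.
Local Notation mu := ((@lebesgue_tuple R n) \x (@lebesgue_measure R)).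
Local Notation T := (spacetime R n).

Lemma weight_integral_box (w g : T -> R) x L a b :
  weight w -> measurable_fun setT g -> (forall z, 0 <= g z)%R ->
  (\forall z \ae mu, w z = g z) ->
  \int[mu]_(z in box x L a b) (g z)%:E < +oo.
Proof.
move=> [_ w0 wK] mg g0 wg.
pose K : set T := cube x L `*` `[a, b]%classic.
have mK : measurable K by apply: measurableX; [exact: measurable_cube|exact: measurable_itv].
have cK : compact_st K.
  rewrite /compact_st.
  have -> : (fun z : T => ((\row_i tnth z.1 i)%R, z.2) : 'rV[R]_n * R) @` K =
     [set u : 'rV[R]_n | forall i, `[(tnth x i - L)%R, (tnth x i + L)%R]%classic (u ord0 i)]
     `*` `[a, b]%classic.
    apply/seteqP; split => [_ [z [/= z1 z2] <-]|[u t] [/= u1 t1]].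
      by split => //= i; rewrite mxE in_itv /= -ler_distl; exact: z1.
    exists ([tuple u ord0 i | i < n], t).
      by split => //= i; rewrite tnth_mktuple ler_distl; have := u1 i; rewrite in_itv.
    by congr pair; apply/rowP => i; rewrite mxE tnth_mktuple.
  apply: compact_setX; last exact: segment_compact.
  apply: (@rV_compact _ n (fun i => `[(tnth x i - L)%R, (tnth x i + L)%R]%classic)) => i.
  exact: segment_compact.
have mgE D : measurable_fun D (fun z => (g z)%:E).
  by apply/measurable_EFinP; exact: measurable_funTS.
apply: (@le_lt_trans _ _ (\int[mu]_(z in K) (w z)%:E)); last exact: wK.
rewrite (@ge0_integral_ae _ _ _ mu K (fun z => (w z)%:E) (fun z => (g z)%:E))//.
- apply: integral_subset_le => //; first exact: measurable_box.
  by move=> z [/= z1 z2]; split => //=; exact: subset_itv_oo_cc.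
- case: wg => N [mN N0 wgN]; exists N; split => // z /= h.
  by apply: wgN => /= e; apply: h; rewrite e.
Qed.

End local_integrability.


(** * Comparison of the lower and the upper part *)

Section muckenhoupt_comparison.
Context {R : realType} {n : nat}.
Local Notation mu := ((@lebesgue_tuple R n) \x (@lebesgue_measure R)).
Local Notation T := (spacetime R n).
Variables (p q gam : R) (w g : T -> R).
Hypotheses (p1 : (1 <= p)%R) (q1 : (1 <= q)%R) (gam0 : (0 < gam)%R) (gam1 : (gam < 1)%R).
Hypotheses (wA : muckenhoupt_plus p gam q w) (mg : measurable_fun setT g)
  (g0 : forall z, (0 <= g z)%R) (wg : \forall z \ae mu, w z = g z).

Let wW : weight w. Proof. by case: wA. Qed.
Let w0 z : (0 <= w z)%R. Proof. by case: wW. Qed.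

(** The common measure of the lower and the upper part of a rectangle of side [L]. *)
Definition part_vol (L : R) : R := ((2 * L) ^+ n * ((1 - gam) * L `^ p))%R.

Lemma part_vol_gt0 L : (0 < L)%R -> (0 < part_vol L)%R.
Proof.
by move=> L0; rewrite /part_vol mulr_gt0 ?exprn_gt0 ?mulr_gt0 ?powR_gt0 ?subr_gt0.
Qed.

(** The lower part of a rectangle, described by the time [s] at which it begins; the
    upper part is its translate in time. *)
Definition lower_box (x : vect R n) (L s : R) : set T :=
  box x L s (s + (1 - gam) * L `^ p)%R.

Definition upper_box (x : vect R n) (L s : R) : set T :=
  lower_box x L (s + (1 + gam) * L `^ p)%R.

Lemma mu_lower_box x L s : (0 < L)%R -> mu (lower_box x L s) = (part_vol L)%:E.
Proof.
move=> L0; rewrite /lower_box mu_box ?(ltW L0)//.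
  by congr EFin; rewrite /part_vol; ring.
by rewrite lerDl mulr_ge0 ?powR_ge0// subr_ge0 ltW.
Qed.

Lemma avgE (A : set T) (f : T -> \bar R) (v : R) : (0 < v)%R -> mu A = v%:E ->
  avg A f = (v^-1)%:E * \int[mu]_(z in A) f z.
Proof. by move=> v0 Av; rewrite /avg Av inver gt_eqF. Qed.

Lemma integral_version (A : set T) (h : R -> \bar R) : measurable A ->
  (forall a, 0 <= h a) -> measurable_fun setT (fun z => h (g z)) ->
  \int[mu]_(z in A) h (w z) = \int[mu]_(z in A) h (g z).
Proof.
move=> mA h0 mh; apply: ge0_integral_ae => //.
case: wg => N [mN N0 wgN]; exists N; split => // z /= hz.
by apply: wgN => /= e; apply: hz; rewrite e.
Qed.

Lemma measurable_neg_pow s : measurable_fun setT (fun z => neg_pow (g z) s).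
Proof.
apply: measurable_fun_ifT => //.
- exact: measurable_fun_eqr.
- by apply/measurable_EFinP; exact: measurable_powR_fun.
Qed.

Lemma neg_pow_ge (a s e : R) : (0 <= a)%R -> (a <= s)%R -> (e <= 0)%R ->
  (s `^ e)%:E <= neg_pow a e.
Proof.
move=> a0 as' e0; rewrite /neg_pow; case: eqVneq => [_|a1]; first exact: leey.
have ap : (0 < a)%R by rewrite lt_neqAle eq_sym a1.
rewrite lee_fin -(opprK e) !(powRN _ (- e)) lef_pV2 ?posrE ?powR_gt0 ?(lt_le_trans ap)//.
by apply: ge0_ler_powR; rewrite ?nnegrE ?oppr_ge0 ?(le_trans a0).
Qed.

(** On [F] the function w^(1/(1-q)) is at least a^(1/(1-q)), which bounds from below
    the dual average in the A_q condition; for q = 1, the essential infimum over the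
    upper part is at most [a] because [F] has positive measure. *)
Lemma average_le_level (theta : R) : (0 < theta)%R ->
  exists2 C : R, (0 < C)%R & forall x L s a (F : set T), (0 < L)%R -> (0 < a)%R ->
    measurable F -> F `<=` upper_box x L s -> (theta * part_vol L)%:E <= mu F ->
    (forall z, F z -> g z <= a)%R ->
    \int[mu]_(z in lower_box x L s) (g z)%:E <= (C * a * part_vol L)%:E.
Proof.
move=> th0.
have mbox x L s : measurable (lower_box x L s) by exact: measurable_box.
have mgE A : measurable_fun A (fun z => (g z)%:E).
  by apply/measurable_EFinP; exact: measurable_funTS.
have intw A : measurable A -> \int[mu]_(z in A) (w z)%:E = \int[mu]_(z in A) (g z)%:E.
  move=> mA; apply: ge0_integral_ae => //.
  case: wg => N [mN N0 wgN]; exists N; split => // z /= hz.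
  by apply: wgN => /= e; apply: hz; rewrite e.
have rect x L s (L0 : (0 < L)%R) : let Q := Prect x (s + L `^ p)%R L0 in
    lower p gam Q = lower_box x L s /\ upper p gam Q = upper_box x L s.
  have e1 : (s + L `^ p - L `^ p = s)%R by ring.
  have e2 : (s + L `^ p - gam * L `^ p = s + (1 - gam) * L `^ p)%R by ring.
  have e3 : (s + L `^ p + gam * L `^ p = s + (1 + gam) * L `^ p)%R by ring.
  have e4 : (s + L `^ p + L `^ p = s + (1 + gam) * L `^ p + (1 - gam) * L `^ p)%R by ring.
  by rewrite /lower /upper /upper_box /lower_box /box /= e1 e2 e3 e4.
have avgl x L s : (0 < L)%R -> avg (lower_box x L s) (fun z => (w z)%:E) =
    ((part_vol L)^-1)%:E * \int[mu]_(z in lower_box x L s) (g z)%:E.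
  by move=> L0; rewrite (avgE _ (part_vol_gt0 L0) (mu_lower_box x s L0)) intw.
case: wA => _ [[q1' [C C0 HC]]|[q1' HA]].
  exists C => // x L s a F L0 a0 mF FU muF ga.
  have [lE uE] := rect x L s L0.
  have := HC (Prect x (s + L `^ p)%R L0); rewrite lE uE avgl//.
  rewrite lee_pdivrMl ?part_vol_gt0// => /le_trans; apply.
  rewrite [(C * a * _)%R]mulrC [leRHS]EFinM; apply: lee_wpmul2l; first by rewrite lee_fin ltW// part_vol_gt0.
  rewrite [leRHS]EFinM; apply: lee_wpmul2l; first by rewrite lee_fin ltW.
  apply: ge_ereal_sup => y /= yw; rewrite leNgt; apply/negP => ay.
  have F0 : mu F = 0.
    apply: measure_negligible => //.
    case: wg => N [mN N0 wgN]; case: yw => N' [mN' N0' ywN'].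
    exists (N `|` N'); split; [exact: measurableU|exact: null_set_setU|].
    move=> z Fz; apply: contrapT => nNN; apply: nNN.
    have [wgz|nwg] := pselect (w z = g z); last by left; apply: wgN.
    right; apply: ywN' => /= h; have := h (FU z Fz).
    by rewrite wgz leNgt (le_lt_trans _ ay)// lee_fin ga.
  by move: muF; rewrite F0 lee_fin leNgt mulr_gt0 ?part_vol_gt0.
have [A A0 HAA] : exists2 A : R, (0 < A)%R & Aq_constant p gam q w <= A%:E.
  case: (Aq_constant p gam q w) HA => [A _| |] //; last by exists 1%R; rewrite ?leNye.
  by exists (Num.max A 1)%R; rewrite ?lt_max ?ltr01 ?orbT// lee_fin le_max lexx.
have q10 : (0 < q - 1)%R by rewrite subr_gt0.
have sq0 : ((1 - q)^-1 <= 0)%R by rewrite invr_le0 subr_le0.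
exists (A * (theta `^ (q - 1))^-1)%R.
  by rewrite mulr_gt0 ?invr_gt0 ?powR_gt0.
move=> x L s a F L0 a0 mF FU muF ga.
have [lE uE] := rect x L s L0.
have v0 := part_vol_gt0 L0.
pose low := avg (lower_box x L s) (fun z => (w z)%:E).
pose up := avg (upper_box x L s) (fun z => neg_pow (w z) (1 - q)^-1).
have lu : low * up `^ (q - 1) <= A%:E.
  apply: le_trans HAA; apply: ereal_sup_ubound.
  by exists (Prect x (s + L `^ p)%R L0) => //; rewrite lE uE.
have low0 : 0 <= low.
  rewrite /low avgl//; apply: mule_ge0; first by rewrite lee_fin invr_ge0 ltW.
  by apply: integral_ge0 => z _; rewrite lee_fin.
have np0 b : 0 <= neg_pow b (1 - q)^-1.
  by rewrite /neg_pow; case: ifP => // _; rewrite lee_fin powR_ge0.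
have mU : measurable (upper_box x L s) by exact: mbox.
have up_ge : (theta * a `^ (1 - q)^-1)%:E <= up.
  rewrite /up (avgE _ v0 (mu_lower_box x _ L0)).
  rewrite (integral_version (h := fun b => neg_pow b (1 - q)^-1))//; last first.
    exact: measurable_neg_pow.
  rewrite lee_pdivlMl//.
  apply: (@le_trans _ _ (\int[mu]_(z in F) neg_pow (g z) (1 - q)^-1)); last first.
    apply: ge0_subset_integral => //.
    exact: measurable_funTS (measurable_neg_pow _).
  apply: (@le_trans _ _ (\int[mu]_(z in F) (cst (a `^ (1 - q)^-1)%:E z))); last first.
    apply: ge0_le_integral => //.
    - by move=> z _; rewrite lee_fin powR_ge0.
    - exact: measurable_funTS (measurable_neg_pow _).
    - by move=> z Fz; apply: neg_pow_ge => //; exact: ga.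
  rewrite integral_cst// [leLHS](_ : _ = (a `^ (1 - q)^-1)%:E * (theta * part_vol L)%:E).
    by apply: lee_wpmul2l => //; rewrite lee_fin powR_ge0.
  by rewrite -!EFinM; congr EFin; ring.
have pw : (theta `^ (q - 1) * a^-1)%:E <= up `^ (q - 1).
  have -> : (theta `^ (q - 1) * a^-1)%:E = (theta * a `^ (1 - q)^-1)%:E `^ (q - 1).
    rewrite poweR_EFin; congr EFin; rewrite powRM ?powR_ge0 ?(ltW th0)// -powRrM.
    have -> : ((1 - q)^-1 * (q - 1) = -1)%R.
      by rewrite -opprB invrN mulNr mulVf// gt_eqF.
    by rewrite powR_inv1// ltW.
  apply: gt0_ler_poweR => //; rewrite ?in_itv/= ?leey ?andbT//.
  - exact: ltW.
  - by rewrite lee_fin mulr_ge0 ?powR_ge0// ltW.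
  - by apply: le_trans up_ge; rewrite lee_fin mulr_ge0 ?powR_ge0// ltW.
have := le_trans (lee_wpmul2l low0 pw) lu.
rewrite /low avgl// -muleA [X in _ * X]muleC muleA -EFinM.
have -> : ((part_vol L)^-1 * (theta `^ (q - 1) * a^-1) =
  (part_vol L * a * (theta `^ (q - 1))^-1)^-1)%R.
  by rewrite !invfM invrK; ring.
have D0 : (0 < part_vol L * a * (theta `^ (q - 1))^-1)%R.
  by apply: mulr_gt0; [exact: mulr_gt0|rewrite invr_gt0 powR_gt0].
rewrite lee_pdivrMl// => /le_trans; apply.
by rewrite -EFinM lee_fin le_eqVlt; apply/orP; left; apply/eqP; ring.
Qed.

End muckenhoupt_comparison.


Section forward_comparison.
Context {R : realType} {n : nat}.
Local Notation mu := ((@lebesgue_tuple R n) \x (@lebesgue_measure R)).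
Local Notation T := (spacetime R n).
Variables (p gam : R) (g : T -> R).
Hypotheses (p1 : (1 <= p)%R) (gam0 : (0 < gam)%R) (gam1 : (gam < 1)%R).
Hypotheses (mg : measurable_fun setT g) (g0 : forall z, (0 <= g z)%R).
Hypothesis gfin : forall x L a b, \int[mu]_(z in box x L a b) (g z)%:E < +oo.

Let p0 : (0 < p)%R. Proof. exact: lt_le_trans p1. Qed.
Let gam1' : (0 < 1 - gam)%R. Proof. by rewrite subr_gt0. Qed.

Local Notation pvol := (@part_vol R n p gam).
Local Notation lbox := (@lower_box R n p gam).
Local Notation ubox := (@upper_box R n p gam).

Let pvol_gt0 L : (0 < L)%R -> (0 < pvol L)%R.
Proof. exact: part_vol_gt0. Qed.

Let mu_lbox x L s : (0 < L)%R -> mu (lbox x L s) = (pvol L)%:E.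
Proof. exact: mu_lower_box. Qed.

Let mbox x L s : measurable (lbox x L s).
Proof. exact: measurable_box. Qed.

Definition forward_comparable := forall theta : R, (0 < theta)%R ->
  exists2 C : R, (0 < C)%R & forall x L s (E : set T), (0 < L)%R ->
    measurable E -> E `<=` ubox x L s -> (theta * pvol L)%:E <= mu E ->
    \int[mu]_(z in lbox x L s) (g z)%:E <= C%:E * \int[mu]_(z in E) (g z)%:E.

(** By Chebyshev, on at least half of [E] the function is at most twice its average
    over [E]; [del] covers the case of a zero average. *)
Lemma forward_comparableP :
  (forall theta : R, (0 < theta)%R ->
    exists2 C : R, (0 < C)%R & forall x L s a (F : set T), (0 < L)%R -> (0 < a)%R ->
      measurable F -> F `<=` ubox x L s -> (theta * pvol L)%:E <= mu F ->
      (forall z, F z -> g z <= a)%R ->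
      \int[mu]_(z in lbox x L s) (g z)%:E <= (C * a * pvol L)%:E) ->
  forward_comparable.
Proof.
move=> H theta th0; have [|C C0 HC] := H (theta / 2)%R; first by rewrite divr_gt0.
exists (2 * C / theta)%R; first by rewrite !mulr_gt0 ?invr_gt0.
move=> x L s E L0 mE EU muE.
have v0 := pvol_gt0 L0.
have [W W0 WE] : exists2 W : R, (0 <= W)%R & \int[mu]_(z in E) (g z)%:E = W%:E.
  have i0 : 0 <= \int[mu]_(z in E) (g z)%:E by apply: integral_ge0 => z _; rewrite lee_fin.
  exists (fine (\int[mu]_(z in E) (g z)%:E)); first exact: fine_ge0.
  rewrite fineK// ge0_fin_numE//; apply: le_lt_trans (gfin x L _ _).
  by apply: (integral_subset_le mu mg g0 mE _ EU); exact: mbox.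
have [e eE] : exists e : R, mu E = e%:E.
  exists (fine (mu E)); rewrite fineK// ge0_fin_numE//.
  apply: (@le_lt_trans _ _ (mu (ubox x L s))).
    by apply: le_measure; rewrite ?inE//; exact: mbox.
  by rewrite mu_lbox// ltry.
move: muE; rewrite eE lee_fin => ve.
have e0 : (0 < e)%R by apply: lt_le_trans ve; exact: mulr_gt0.
rewrite WE; apply/lee_addgt0Pr => eta eta0.
pose del := (eta / (C * pvol L))%R.
have del0 : (0 < del)%R by rewrite divr_gt0// mulr_gt0.
pose a := (2 * W / e + del)%R.
have a0 : (0 < a)%R by rewrite ltr_wpDl// divr_ge0 ?(ltW e0)// mulr_ge0.
pose F := E `\` [set z | a < g z]%R.
have mF : measurable F by apply: measurableD => //; exact: measurable_gt.
have [b bE] : exists b : R, mu (E `\` F) = b%:E.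
  exists (fine (mu (E `\` F))); rewrite fineK// ge0_fin_numE//.
  apply: (@le_lt_trans _ _ (mu E)); last by rewrite eE ltry.
  by apply: le_measure; rewrite ?inE//; exact: measurableD.
have ab : (a * b <= W)%R.
  rewrite -lee_fin EFinM -bE -WE -integral_cst; last exact: measurableD.
  apply: (@le_trans _ _ (\int[mu]_(z in E `\` F) (g z)%:E)).
    apply: ge0_le_integral => //.
    - exact: measurableD.
    - by move=> z _; rewrite lee_fin ltW.
    - by apply/measurable_EFinP; exact: measurable_funTS.
    - move=> z [Ez nF]; rewrite lee_fin leNgt; apply/negP => ga; apply: nF.
      by split => //= h; have := lt_trans ga h; rewrite ltxx.
  by apply: (integral_subset_le mu mg g0) => //; exact: measurableD.
have be : (b <= e / 2)%R.
  have aeW : (2 * W <= a * e)%R.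
    rewrite -ler_pdivrMr// /a lerDl; exact: ltW.
  have : (a * b <= a * (e / 2))%R by lra.
  by rewrite ler_pM2l.
have muF : mu F = (e - b)%:E.
  have -> : F = E `&` F by rewrite setIidr//; exact: subDsetl.
  exact: measureI_fin.
apply: (le_trans (HC x L s a F L0 a0 mF _ _ _)).
- by move=> z [/EU].
- by rewrite muF lee_fin; lra.
- by move=> z [_ /= /negP]; rewrite -leNgt.
rewrite -EFinM -EFinD lee_fin.
have -> : (C * a * pvol L = 2 * C * W * (pvol L / e) + eta)%R.
  by rewrite /a /del; field; rewrite !gt_eqF.
rewrite lerD2r [leRHS]mulrAC; apply: ler_wpM2l; first by rewrite !mulr_ge0// ltW.
by rewrite ler_pdivrMr// ler_pdivlMl.
Qed.

Hypothesis fwd : forward_comparable.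

(** A lower part of side [lag_ratio * r] lasts as long as a ball of radius [r]. *)
Definition lag_ratio : R := ((2 / (1 - gam)) `^ p^-1)%R.

Lemma lag_ratio_powR : (lag_ratio `^ p = 2 / (1 - gam))%R.
Proof. by rewrite /lag_ratio -powRrM mulVf ?gt_eqF// powRr1// divr_ge0// ltW. Qed.

Lemma lag_ratio_ge1 : (1 <= lag_ratio)%R.
Proof.
apply: powR_ge1; first by rewrite invr_ge0 ltW.
by have := gam0; rewrite ler_pdivlMr//; lra.
Qed.

Lemma lbox_pball (z : T) r : (0 < r)%R ->
  lbox z.1 (lag_ratio * r)%R (z.2 - r `^ p)%R =
  box z.1 (lag_ratio * r)%R (z.2 - r `^ p)%R (z.2 + r `^ p)%R.
Proof.
move=> r0; have k0 := le_trans ler01 lag_ratio_ge1.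
rewrite /lower_box powRM ?(ltW r0)// lag_ratio_powR mulrA mulrCA divff ?gt_eqF// mulr1.
by have -> : (z.2 - r `^ p + 2 * r `^ p = z.2 + r `^ p)%R by ring.
Qed.

Lemma pball_sub_lbox (z : T) r : (0 < r)%R ->
  pball p z r `<=` lbox z.1 (lag_ratio * r)%R (z.2 - r `^ p)%R.
Proof.
move=> r0; rewrite lbox_pball// => y [h1 h2]; split => //= i.
by apply: le_trans (h1 i) _; rewrite ler_peMl ?(ltW r0)// lag_ratio_ge1.
Qed.



(** If the values at most [beta * lam] filled half of the upper part that follows a
    ball, the comparison would make the average over the ball at most [lam]. *)
Lemma fat_levels_of_forward :
  exists beta K : R, [/\ (0 < beta)%R, (beta <= 1)%R, (1 <= K)%R & fat_levels mu p beta K g].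
Proof.
have [C C0 HC] := fwd (divr_gt0 (ltr01 : (0 < 1 :> R)%R) (ltr0Sn R 1)).
have k1 := lag_ratio_ge1; have k0 := lt_le_trans ltr01 k1.
pose kn : R := (lag_ratio ^+ n)%R.
have kn1 : (1 <= kn)%R by exact: exprn_ege1.
have kn0 : (0 < kn)%R by exact: lt_le_trans kn1.
pose beta := (((C + 1) * kn)^-1)%R.
have b0 : (0 < beta)%R by rewrite invr_gt0 mulr_gt0// addr_gt0.
exists beta, (2 * lag_ratio)%R; split => //.
- rewrite invf_le1 ?mulr_gt0 ?addr_gt0//.
  by apply: le_trans kn1 _; rewrite ler_peMl ?(ltW kn0)// lerDr ltW.
- by apply: le_trans k1 _; rewrite ler_peMl ?(ltW k0)// ler1n.
move=> z r lam r0 lam0 h; rewrite leNgt; apply/negP => small.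
pose L := (lag_ratio * r)%R; pose s := (z.2 - r `^ p)%R.
have L0 : (0 < L)%R by exact: mulr_gt0.
have rL : (r <= L)%R by rewrite ler_peMl// ltW.
pose S := [set y | (beta * lam < g y)%R].
have mS : measurable S by exact: measurable_gt.
have Up : ubox z.1 L s `<=` pball p z (2 * lag_ratio * r).
  rewrite -mulrA => y [y1 y2]; split => /=.
    by move=> i; apply: le_trans (y1 i) _; rewrite ler_peMl ?(ltW L0)// ler1n.
  move: y2; rewrite /= !in_itv /= => /andP[y2 y3].
  have h1 : (L `^ p + L `^ p <= (2 * L) `^ p)%R.
    have := powR_superadd p1 (ltW L0) (ltW L0).
    by have -> : (L + L = 2 * L)%R by ring.
  have h2 : (0 <= gam * L `^ p)%R by rewrite mulr_ge0 ?powR_ge0// ltW.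
  have h3 : (r `^ p <= L `^ p)%R by apply: ler_powRp => //; exact: ltW.
  have h4 : (0 < r `^ p)%R by exact: powR_gt0.
  by move: y2 y3; rewrite /s => y2 y3; apply/andP; split; lra.
have volL : (pvol L = kn * @vol R n p r)%R.
  rewrite volE// /part_vol /L powRM ?(ltW r0) ?(ltW k0)// lag_ratio_powR /kn.
  have -> : (2 * (lag_ratio * r) = lag_ratio * (2 * r))%R by ring.
  rewrite (exprMn n lag_ratio); field.
  by rewrite gt_eqF.
have v0 : (0 < @vol R n p r)%R by exact: vol_gt0.
have US : mu (ubox z.1 L s `&` S) <= (@vol R n p r / 2)%:E.
  apply: le_trans (ltW small); apply: le_measure; rewrite ?inE.
  - by apply: measurableI => //; exact: mbox.
  - by apply: measurableI => //; exact: measurable_pball.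
  - exact: setSI.
have [b bE] : exists b : R, mu (ubox z.1 L s `&` S) = b%:E.
  by exists (fine (mu (ubox z.1 L s `&` S))); rewrite fineK// ge0_fin_numE// (le_lt_trans US)// ltry.
move: US; rewrite bE lee_fin => bv.
pose E := ubox z.1 L s `&` ~` S.
have mE : measurable E by apply: measurableI; [exact: mbox|exact: measurableC].
have muE : mu E = (pvol L - b)%:E.
  apply: measureI_fin; [exact: mbox|exact: measurableC|exact: mu_lbox|].
  by rewrite setDE setCK.
have b0' : (0 <= b)%R by rewrite -lee_fin -bE.
have EV : (1 / 2 * pvol L)%:E <= mu E.
  rewrite muE lee_fin volL; have := ler_wpM2r (ltW v0) kn1; lra.
have := HC z.1 L s E L0 mE (@subIsetl _ _ _) EV.
apply/negP; rewrite -ltNge.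
apply: (@lt_le_trans _ _ (lam * @vol R n p r)%:E); last first.
  apply: (le_trans (ltW h)); apply: (integral_subset_le mu mg g0).
  - exact: measurable_pball.
  - exact: mbox.
  - exact: pball_sub_lbox.
apply: (@le_lt_trans _ _ (C%:E * ((beta * lam)%:E * mu E))).
  apply: lee_wpmul2l; first by rewrite lee_fin ltW.
  apply: (integral_le_measure mu mg g0 mE); first by rewrite mulr_ge0 ?ltW.
  by move=> y [_ /= /negP]; rewrite -leNgt.
rewrite muE -!EFinM lte_fin.
apply: (@le_lt_trans _ _ (C * (beta * lam * pvol L))%R).
  apply: ler_wpM2l; first exact: ltW.
  by apply: ler_wpM2l; [rewrite mulr_ge0 ?ltW|lra].
have -> : (C * (beta * lam * pvol L) = C / (C + 1) * (lam * @vol R n p r))%R.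
  by rewrite volL /beta; field; rewrite !gt_eqF// addr_gt0.
rewrite gtr_pMl; last exact: mulr_gt0.
by rewrite ltr_pdivrMr ?addr_gt0// mul1r ltrDl.
Qed.

(** The upper part is the lower part moved by [(1 + gam) * L `^ p]. *)
Lemma forward_shift : exists2 C : R, (1 <= C)%R & forall k x L s, (0 < L)%R ->
  \int[mu]_(z in lbox x L s) (g z)%:E <=
  (C ^+ k)%:E * \int[mu]_(z in lbox x L (s + k%:R * ((1 + gam) * L `^ p))) (g z)%:E.
Proof.
have [C C0 HC] := fwd (ltr01 : (0 < 1 :> R)%R).
have C1 : (1 <= C + 1)%R by rewrite lerDr ltW.
have C10 : (0 <= C + 1)%R by exact: le_trans C1.
exists (C + 1)%R => // k x L s L0; elim: k => [|k IH].
  by rewrite expr0 mul1e mul0r addr0.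
apply: (le_trans IH); rewrite exprSr EFinM -muleA.
apply: lee_wpmul2l; first by rewrite lee_fin exprn_ge0.
set s' := (s + k%:R * _)%R.
have -> : (s + k.+1%:R * ((1 + gam) * L `^ p) = s' + (1 + gam) * L `^ p)%R.
  by rewrite /s' -natr1; ring.
apply: (@le_trans _ _ (C%:E * \int[mu]_(z in ubox x L s') (g z)%:E)).
  apply: HC => //; first exact: mbox.
  by rewrite mul1r mu_lbox.
apply: lee_wpmul2r; last by rewrite lee_fin lerDl.
by apply: integral_ge0 => z _; rewrite lee_fin.
Qed.

End forward_comparison.


(** * From balls to rectangles *)

Section reverse_hoelder_rectangle.
Context {R : realType} {n : nat}.
Local Notation mu := ((@lebesgue_tuple R n) \x (@lebesgue_measure R)).
Local Notation T := (spacetime R n).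
Variables (p gam : R) (g : T -> R).
Hypotheses (p1 : (1 <= p)%R) (gam0 : (0 < gam)%R) (gam1 : (gam < 1)%R).
Hypotheses (mg : measurable_fun setT g) (g0 : forall z, (0 <= g z)%R).
Hypothesis gfin : forall x L a b, \int[mu]_(z in box x L a b) (g z)%:E < +oo.
Hypothesis fwd : @forward_comparable R n p gam g.

Local Notation kap := (@lag_ratio R p gam).
Local Notation lbox := (@lower_box R n p gam).
Local Notation ubox := (@upper_box R n p gam).

Let k1 : (1 <= kap)%R. Proof. exact: lag_ratio_ge1. Qed.
Let k0 : (0 < kap)%R. Proof. exact: lt_le_trans k1. Qed.

Lemma clamp (x z M h : R) : (0 <= M)%R -> (0 <= h)%R -> (`|z - x| <= M + h)%R ->
  exists y : R, (`|y - x| <= M)%R /\ (`|y - z| <= h)%R.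
Proof.
move=> M0 h0; rewrite ler_distl => /andP[z1 z2].
have [zl|zl] := leP z (x - M)%R.
  by exists (x - M)%R; split; rewrite ler_distl; apply/andP; split; lra.
have [zr|zr] := leP (x + M)%R z.
  by exists (x + M)%R; split; rewrite ler_distl; apply/andP; split; lra.
by exists z; split; rewrite ler_distl; apply/andP; split; lra.
Qed.

Lemma powR_quarter (L : R) : (0 <= L)%R -> (4 * (L / 4) `^ p <= L `^ p)%R.
Proof.
move=> L0; have q0 : (0 <= L / 4)%R by rewrite divr_ge0.
have h := powR_superadd p1 q0 q0.
have q2 : (0 <= L / 4 + L / 4)%R by exact: addr_ge0.
have := powR_superadd p1 q2 q2.
have -> : (L / 4 + L / 4 + (L / 4 + L / 4) = L)%R by field.
by lra.
Qed.

(** The ball lies in a lower part of side [rho], a quarter of the side of the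
    rectangle.  The box of half that side nearest to its center inside the cube of
    the rectangle fills a fixed portion of the corresponding upper part.  Moved
    forward until it starts after the center time, it ends before the end of the
    rectangle, because its steps are short. *)
Lemma ball_le_upper : exists2 C : R, (0 < C)%R & forall (Q : prect R n) z,
  lower p 0 Q z ->
  \int[mu]_(y in pball p z (side Q / (4 * kap))) (g y)%:E <=
  C%:E * \int[mu]_(y in upper p 0 Q) (g y)%:E.
Proof.
have [C1 C11 shift] := forward_shift gam1 g0 fwd.
have p0 : (0 < p)%R by exact: lt_le_trans p1.
pose theta : R := (2^-1 ^+ n * 2^-1 `^ p)%R.
have th0 : (0 < theta)%R by rewrite mulr_gt0 ?exprn_gt0 ?powR_gt0 ?invr_gt0.
have [C2 C20 HC2] := fwd th0.
(* the side of the moved box is an eighth of that of the rectangle *)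
pose K0 := (Num.truncn ((8 : R) `^ p)%R).+1.
exists (C2 * C1 ^+ K0)%R; first by rewrite mulr_gt0// exprn_gt0// (lt_le_trans ltr01).
move=> [x t L L0] z /= [/= zx]; rewrite mul0r subr0 in_itv /= => /andP[zt1 zt2].
pose rho := (L / 4)%R; pose r := (L / (4 * kap))%R.
have rho0 : (0 < rho)%R by rewrite divr_gt0.
have r0 : (0 < r)%R by rewrite divr_gt0// mulr_gt0.
have krho : (kap * r = rho)%R by rewrite /r /rho; field; rewrite gt_eqF.
have rrho : (r `^ p <= rho `^ p)%R.
  by apply: ler_powRp => //; [exact: ltW|rewrite -krho ler_peMl// ltW].
have rp0 : (0 < r `^ p)%R by exact: powR_gt0.
have rhop0 : (0 < rho `^ p)%R by exact: powR_gt0.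
pose s := (z.2 - r `^ p)%R.
have mbx y l b : measurable (lbox y l b) by exact: measurable_box.
(* squeeze the box sideways into the cube of the rectangle *)
have [y yP] : exists y : vect R n, forall i,
    (`|(tnth y i : R) - tnth x i| <= L - rho / 2)%R /\
    (`|(tnth y i : R) - tnth z.1 i| <= rho / 2)%R.
  have /choice[f fP] : forall i, exists y : R, (`|y - tnth x i| <= L - rho / 2)%R /\
     (`|y - tnth z.1 i| <= rho / 2)%R.
    move=> i; apply: clamp; first by rewrite /rho; lra.
      by rewrite divr_ge0// ltW.
    by apply: le_trans (zx i) _; lra.
  by exists [tuple f i | i < n] => i; rewrite tnth_mktuple.
pose s' := (s + (1 + gam) * rho `^ p)%R.
pose h := (rho / 2)%R.
have h0 : (0 < h)%R by rewrite divr_gt0.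
have hrho : (h `^ p <= rho `^ p)%R.
  by apply: ler_powRp => //; [exact: ltW|rewrite /h; lra].
have hp0 : (0 < h `^ p)%R by exact: powR_gt0.
have EU : lbox y h s' `<=` ubox z.1 rho s.
  move=> u [/= u1 u2]; split => /=.
    move=> i; apply: le_trans (ler_distD (tnth y i : R) _ _) _.
    have [_ h2] := yP i; have := u1 i; rewrite /h; lra.
  move: u2; rewrite !in_itv /= => /andP[-> /= u2]; apply: (lt_le_trans u2).
  by rewrite lerD2l ler_wpM2l// subr_ge0 ltW.
have muE : (theta * @part_vol R n p gam rho)%:E <= mu (lbox y h s').
  rewrite mu_lower_box// lee_fin /part_vol /theta /h.
  have -> : (2 * (rho / 2) = 2^-1 * (2 * rho))%R by field.
  have -> : (rho / 2 = 2^-1 * rho)%R by rewrite mulrC.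
  rewrite [((2^-1 * (2 * rho)) ^+ n)%R]exprMn (@powRM _ 2^-1%R rho) ?invr_ge0 ?(ltW rho0)//.
  by rewrite le_eqVlt; apply/orP; left; apply/eqP; ring.
pose tau := ((1 + gam) * h `^ p)%R.
have gam2 : (1 < 1 + gam)%R by rewrite ltrDl.
have tau0 : (0 < tau)%R by rewrite mulr_gt0// (lt_trans ltr01).
have htau : (h `^ p <= tau)%R by rewrite ler_peMl ?ltW.
pose m := ((t - s') / tau)%R.
(* at least one step, even if the box starts after [t] already *)
pose k := (Num.truncn m).+1.
have tk : (t < s' + k%:R * tau)%R.
  by rewrite -ltrBlDl -ltr_pdivrMr//; exact: truncnS_gt.
have s'le : (s' <= t + 2 * rho `^ p)%R.
  rewrite /s' /s; have := ler_wpM2r (ltW rhop0) (ltW gam1); lra.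
have kt : (s' + k%:R * tau <= t + 2 * rho `^ p + tau)%R.
  rewrite /k -natr1 mulrDl mul1r addrA lerD2r.
  have [m0|m0] := leP 0%R m.
    have /andP[+ _] := truncn_itv m0; rewrite /m ler_pdivlMr//; lra.
  by rewrite (_ : Num.truncn m = 0)%N ?mul0r ?addr0//; apply/eqP; rewrite -leqn0 truncn_le_nat (lt_trans m0).
have kK : (k <= K0)%N.
  rewrite ltnS; apply: le_truncn; rewrite /m ler_pdivrMr//.
  have L8 : (L `^ p = 8 `^ p * h `^ p)%R.
    by rewrite -powRM ?(ltW h0)//; congr (_ `^ _)%R; rewrite /h /rho; field.
  apply: (@le_trans _ _ (L `^ p)%R); last by rewrite L8 ler_wpM2l ?powR_ge0.
  rewrite /s' /s; have : (0 <= gam * rho `^ p)%R by rewrite mulr_ge0 ?ltW.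
  lra.
have EQ : lbox y h (s' + k%:R * tau) `<=` upper p 0 (Prect x t L0).
  move=> u [/= u1 u2]; split => /=.
    move=> i; apply: le_trans (ler_distD (tnth y i : R) _ _) _.
    have [h2 _] := yP i; have := u1 i; rewrite /h; lra.
  move: u2; rewrite !in_itv /= mul0r addr0 => /andP[u2 u3].
  rewrite (lt_trans tk u2) /=; apply: (lt_le_trans u3).
  have := powR_quarter (ltW L0); rewrite -/rho.
  have : (tau + (1 - gam) * h `^ p = 2 * h `^ p)%R by rewrite /tau; ring.
  lra.
apply: (@le_trans _ _ (\int[mu]_(u in lbox z.1 rho s) (g u)%:E)).
  apply: (integral_subset_le mu mg g0) => //; first exact: measurable_pball.
  by rewrite -krho; exact: pball_sub_lbox.
apply: (le_trans (HC2 z.1 rho s _ rho0 (mbx _ _ _) EU muE)).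
rewrite EFinM -muleA; apply: lee_wpmul2l; first by rewrite lee_fin ltW.
apply: (le_trans (shift k y h s' h0)).
apply: lee_pmul.
- by rewrite lee_fin exprn_ge0// (le_trans ler01).
- by apply: integral_ge0 => u _; rewrite lee_fin.
- by rewrite lee_fin ler_weXn2l.
- apply: (integral_subset_le mu mg g0) => //.
  by apply: measurableX; [exact: measurable_cube|exact: measurable_itv].
Qed.

(** The average [a] is that of the upper part, up to a constant, plus a positive
    amount that covers the case of a zero average. *)
Lemma reverse_hoelder_rectangle :
  exists eps c : R, [/\ (0 < eps)%R, (0 < c)%R & forall Q : prect R n,
    avg (lower p 0 Q) (fun z => (g z `^ (1 + eps))%:E) `^ (1 + eps)^-1 <=
    c%:E * avg (upper p 0 Q) (fun z => (g z)%:E)].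
Proof.
have [beta [K [b0 b1 K1 fat]]] := fat_levels_of_forward p1 gam0 gam1 mg g0 fwd.
have muB (z : T) r : (0 < r)%R -> mu (pball p z r) = (@vol R n p r)%:E.
  exact: mu_pball.
have [eps [X [e0 X0 RH]]] := reverse_hoelder_ball p1 muB b0 b1 K1.
have [C C0 HC] := ball_le_upper.
have k12 : (0 <= 12 * kap)%R by rewrite mulr_ge0 ?(ltW k0).
have [N cover] := @finite_ball_cover R n p p1 _ k12.
pose E := ((6 * kap) `^ (n%:R + p))%R.
have E0 : (0 < E)%R by apply: powR_gt0; apply: mulr_gt0.
pose Y := (2 * N%:R * X + 1)%R.
have NX0 : (0 <= N%:R * X)%R by rewrite mulr_ge0// ltW.
have Y0 : (0 < Y)%R by rewrite /Y; lra.
have e10 : (0 < 1 + eps)%R by exact: addr_gt0.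
pose D := (Y `^ (1 + eps)^-1)%R.
have D0 : (0 < D)%R by exact: powR_gt0.
exists eps, (D * C * E)%R; split => //; first by rewrite !mulr_gt0.
move=> Q; have L0 := side_gt0 Q; set L := side Q in L0.
have V0 : (0 < @vol R n p L)%R by exact: vol_gt0.
have V20 : (0 < @vol R n p L / 2)%R by exact: divr_gt0.
have mlow : measurable (lower p 0 Q).
  by apply: measurableX; [exact: measurable_cube|exact: measurable_itv].
have mup : measurable (upper p 0 Q).
  by apply: measurableX; [exact: measurable_cube|exact: measurable_itv].
have Lp := powR_ge0 L p.
have muV a b : (b - a = L `^ p)%R ->
    mu (box (space_center Q) L a b) = (@vol R n p L / 2)%:E.
  move=> ab; rewrite mu_box ?(ltW L0)//; last by rewrite -subr_ge0 ab.
  by rewrite ab volE//; congr EFin; field.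
have mulow : mu (lower p 0 Q) = (@vol R n p L / 2)%:E.
  by apply: muV; rewrite -/L; ring.
have muup : mu (upper p 0 Q) = (@vol R n p L / 2)%:E.
  by apply: muV; rewrite -/L; ring.
have [W W0 WE] : exists2 W : R, (0 <= W)%R & \int[mu]_(z in upper p 0 Q) (g z)%:E = W%:E.
  have i0 : 0 <= \int[mu]_(z in upper p 0 Q) (g z)%:E.
    by apply: integral_ge0 => z _; rewrite lee_fin.
  exists (fine (\int[mu]_(z in upper p 0 Q) (g z)%:E)); first exact: fine_ge0.
  by rewrite fineK// ge0_fin_numE//; exact: gfin.
rewrite (avgE _ V20 mulow) (avgE _ V20 muup) WE -!EFinM.
pose r := (L / (12 * kap))%R.
have r0 : (0 < r)%R by rewrite divr_gt0// mulr_gt0.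
have v2r : (0 < @vol R n p (2 * r))%R by rewrite vol_gt0// mulr_gt0.
have VE : (@vol R n p L = E * @vol R n p (2 * r))%R.
  have k6 : (0 <= 6 * kap)%R by rewrite mulr_ge0 ?(ltW k0).
  have r2 : (0 <= 2 * r)%R by rewrite mulr_ge0 ?(ltW r0).
  rewrite -(volM p k6 r2); congr (vol _ _).
  by rewrite /r; field; rewrite gt_eqF.
apply/lee_addgt0Pr => eta eta0.
pose a := (C * W / @vol R n p (2 * r) + eta / D)%R.
have CW0 : (0 <= C * W / @vol R n p (2 * r))%R.
  by apply: divr_ge0; [apply: mulr_ge0 => //; exact: ltW|exact: ltW].
have a0 : (0 < a)%R by rewrite ltr_wpDl// divr_gt0.
have mgp : measurable_fun setT (fun z => g z `^ (1 + eps))%R by exact: measurable_powR_fun.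
have gp0 z : (0 <= g z `^ (1 + eps))%R by exact: powR_ge0.
have low : \int[mu]_(z in lower p 0 Q) (g z `^ (1 + eps))%:E <=
    (N%:R * (X * a `^ (1 + eps) * @vol R n p r))%:E.
  pose z0 : T := (space_center Q, time_center Q).
  have [||S0 [S0N S0cov _]] := cover z0 L r _ r0; first exact: ltW.
    by rewrite /r mulrCA divff ?mulr1// mulf_neq0 ?gt_eqF.
  pose S := [seq c <- S0 | `[< lower p 0 Q `&` pball p c r !=set0 >]].
  have SN : (size S <= N)%N by rewrite size_filter (leq_trans (count_size _ _)).
  have Scov : lower p 0 Q `<=` \bigcup_(c in [set` S]) pball p c r.
    move=> u Qu; have [|c /= cS0 cu] := S0cov u.
      move: Qu => [/= u1 u2]; split => //=.
      move: u2; rewrite !in_itv /= mul0r subr0 => /andP[-> /= u2].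
      by apply: lt_le_trans u2 _; rewrite lerDl.
    by exists c => //=; rewrite mem_filter cS0 andbT; apply/asboolP; exists u.
  apply: (@le_trans _ _ (\sum_(c <- S) \int[mu]_(x in pball p c r) (g x `^ (1 + eps))%:E)).
    apply: (@integral_cover R n _ (fun x => (g x `^ (1 + eps))%R)) => //.
    by move=> c; exact: measurable_pball.
  apply: (@le_trans _ _ (\sum_(c <- S) (X * a `^ (1 + eps) * @vol R n p r)%:E)).
    rewrite big_seq [leRHS]big_seq; apply: lee_sum => c.
    rewrite mem_filter => /andP[/asboolP[u [Qu cu]] _].
    apply: RH => //.
    apply: (@le_trans _ _ (C%:E * \int[mu]_(y in upper p 0 Q) (g y)%:E)).
      apply: le_trans (HC Q u Qu); apply: (integral_subset_le mu mg g0).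
      - exact: measurable_pball.
      - exact: measurable_pball.
      - have -> : (side Q / (4 * kap) = r + 2 * r)%R.
          by rewrite /r -/L; field; rewrite gt_eqF.
        apply: sub_pball_center => //; [exact: ltW|by rewrite mulr_ge0// ltW|].
        exact: pball_sym.
    rewrite WE -EFinM lee_fin -ler_pdivrMr// /a lerDl.
    by rewrite ltW// divr_gt0.
  rewrite sumEFin lee_fin big_const_seq count_predT iter_addr_0 -[leLHS]mulr_natl.
  apply: ler_wpM2r; last by rewrite ler_nat.
  by rewrite !mulr_ge0 ?powR_ge0 ?(ltW X0) ?(ltW (vol_gt0 _ _)).
apply: (@le_trans _ _ ((Y * a `^ (1 + eps))%:E `^ (1 + eps)^-1)).
  have l0 : 0 <= ((@vol R n p L / 2)^-1)%:E *
      \int[mu]_(z in lower p 0 Q) (g z `^ (1 + eps))%:E.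
    apply: mule_ge0; first by rewrite lee_fin invr_ge0 ltW.
    by apply: integral_ge0 => z _; rewrite lee_fin.
  apply: gt0_ler_poweR; rewrite ?in_itv/= ?leey ?andbT//.
  - by rewrite invr_ge0 ltW.
  - by rewrite lee_fin mulr_ge0 ?powR_ge0// ltW.
  rewrite lee_pdivrMl//; apply: (le_trans low); rewrite -EFinM lee_fin.
  have rV : (@vol R n p r <= @vol R n p L)%R.
    apply: ler_vol => //; first exact: ltW.
    rewrite /r ler_pdivrMr ?mulr_gt0// ler_peMr ?(ltW L0)//.
    have := k1; lra.
  have ap := powR_ge0 a (1 + eps).
  have -> : (@vol R n p L / 2 * (Y * a `^ (1 + eps)) =
    N%:R * (X * a `^ (1 + eps) * @vol R n p L) + @vol R n p L / 2 * a `^ (1 + eps))%R.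
    by rewrite /Y; field.
  rewrite -[leLHS]addr0; apply: lerD; last by rewrite mulr_ge0// ltW.
  by rewrite ler_wpM2l// ler_wpM2l// mulr_ge0// ltW.
rewrite poweR_EFin powRM ?powR_ge0 ?(ltW Y0)// -powRrM divff ?gt_eqF//.
rewrite powRr1 ?(ltW a0)// -/D -EFinD lee_fin.
have -> : (D * a = D * C * W / @vol R n p (2 * r) + eta)%R.
  by rewrite /a; field; rewrite !gt_eqF.
rewrite lerD2r VE.
have -> : (D * C * E * ((E * @vol R n p (2 * r) / 2)^-1 * W) =
   2 * (D * C * W / @vol R n p (2 * r)))%R.
  by field; rewrite !gt_eqF.
have DCW : (0 <= D * C * W / @vol R n p (2 * r))%R.
  by apply: divr_ge0; [apply: mulr_ge0 => //; apply: mulr_ge0|]; exact: ltW.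
by rewrite ler_peMl// ler1n.
Qed.

End reverse_hoelder_rectangle.

Theorem theorem5p2 (R : realType) (n : nat) (p q gam : R)
    (w : spacetime R n -> R) :
  (0 < n)%N -> (1 < p)%R -> (1 <= q)%R -> (0 < gam)%R -> (gam < 1)%R ->
  muckenhoupt_plus p gam q w ->
  exists eps c : R, (0 < eps)%R /\ (0 < c)%R /\
    forall Q : prect R n,
      avg (lower p 0 Q) (fun z => ((w z) `^ (1 + eps))%:E) `^ (1 + eps)^-1 <=
      c%:E * avg (upper p 0 Q) (fun z => (w z)%:E).
Proof.
move=> _ /ltW p1 q1 gam0 gam1 wA.
have wW : weight w by case: wA.
have [lw w0 _] := wW.
have [g [mg g0 wg]] := borel_version lw w0.
have gfin x L a b := weight_integral_box x L a b wW mg g0 wg.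
have fwd := forward_comparableP gam1 mg g0 gfin
  (average_le_level q1 gam1 wA mg g0 wg).
have [eps [c [e0 c0 H]]] := reverse_hoelder_rectangle p1 gam0 gam1 mg g0 gfin fwd.
exists eps, c; split => //; split => // Q.
have mlow : measurable (lower p 0 Q).
  by apply: measurableX; [exact: measurable_cube|exact: measurable_itv].
have mup : measurable (upper p 0 Q).
  by apply: measurableX; [exact: measurable_cube|exact: measurable_itv].
move: (H Q); rewrite /avg.
rewrite (integral_version wg (h := fun a => (a `^ (1 + eps))%:E) mlow); last 2 first.
- by move=> a; rewrite lee_fin powR_ge0.
- by apply/measurable_EFinP; exact: measurable_powR_fun.
rewrite (@ge0_integral_ae _ _ _ _ _ (fun z => (w z)%:E) (fun z => (g z)%:E) mup)//.
- exact/measurable_EFinP.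
- case: wg => N [mN N0 wgN]; exists N; split => // z /= hz.
  by apply: wgN => /= e; apply: hz; rewrite e.
Qed.
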